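(* For any real isotropic $d\times d$ dilation matrix $A$, with the mask $m_0$ defined from the trigonometric polynomial $G$ as in the context, the corresponding elliptic scaling function $\phi$, whose Fourier transform is $\hat\phi(\xi)=\dfrac{G(\xi)}{P(\xi)}M(\xi)$, is compactly supported.
   Context: A real isotropic dilation matrix is a $d\times d$ matrix $A$ with integer entries, all of whose eigenvalues are greater than $1$ in absolute value, which is diagonalizable over $\mathbb{C}$ and all of whose eigenvalues have equal absolute value. Put $q:=|\det A|$ and $A^{-T}:=(A^T)^{-1}$. One can factor $A^{-T}=q^{-1/d}Q^{-1}UQ$ with $U$ real orthogonal and $Q$ real symmetric positive definite; fix such a $Q$ and write $Q^2=(q_{ij})_{1\le i,j\le d}$. Define $$P(\xi):=\xi^TQ^2\xi=\sum_{i} q_{ii}\xi_i^2+2\sum_{i<j}q_{ij}\xi_i\xi_j,\qquad G(\xi):=4\sum_{i} q_{ii}\sin^2\frac{\xi_i}{2}+2\sum_{i<j}q_{ij}\sin\xi_i\sin\xi_j .$$ Let $S(A^T):=\{s\in[0,1)^d: A^Ts\in\mathbb{Z}^d\}$ (this set has $q$ elements and contains $0$), and define the mask $$m_0(\xi):=\prod_{s\in S(A^T)\setminus\{0\}}\frac{G(\xi+2\pi s)}{G(2\pi s)}.$$ Define $$\mu(\xi):=\frac{q^{2/d}\,m_0(A^{-T}\xi)\,G(A^{-T}\xi)}{G(\xi)},$$ where at the points of $2\pi\mathbb{Z}^d$ (zeros of $G$) the value is understood as the limit, and $M(\xi):=\prod_{j=0}^\infty\mu\bigl((A^{-T})^j\xi\bigr)$.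 The elliptic scaling function $\phi$ is the tempered distribution with $\hat\phi(\xi)=\prod_{j=1}^\infty m_0((A^{-T})^j\xi)=\frac{G(\xi)}{P(\xi)}M(\xi)$ (with $G/P:=1$ at $\xi=0$); the Fourier transform is $\hat f(\xi)=\int_{\mathbb{R}^d} f(x)e^{-i\xi\cdot x}\,dx$. *)

(* Defs.v *)
From HB Require Import structures.
From mathcomp Require Import all_boot all_order all_algebra.
From mathcomp Require Import all_classical all_reals all_analysis.
From mathcomp Require Import complex.

Set Implicit Arguments.
Unset Strict Implicit.
Unset Printing Implicit Defensive.
Import Order.TTheory GRing.Theory Num.Theory.
Import numFieldNormedType.Exports.

Local Open Scope classical_set_scope.
Local Open Scope ring_scope.
Local Open Scope complex_scope.

(* The library has Lebesgue measure on R and binary products only, so the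
   measure on d.-tuple R is built by recursion on d, pushing the product
   measure forward along (x, t) |-> x :: t. *)
Section lebesgue_tuple.
Context {R : realType}.
Local Notation T := (measurableTypeR R).

Definition consp n (p : T * n.-tuple T) : n.+1.-tuple T :=
  [tuple of p.1 :: p.2].

Lemma measurable_consp n : measurable_fun setT (@consp n).
Proof. exact: measurable_cons. Qed.

Lemma measurable_unconsp n :
  measurable_fun setT
    (fun t : n.+1.-tuple T => (thead t, [tuple of behead t])).
Proof.
apply/measurable_fun_pair => /=; first exact: measurable_tnth.
exact: measurable_behead.
Qed.

Lemma conspK n (p : T * n.-tuple T) :
  (thead (consp p), [tuple of behead (consp p)]) = p.
Proof. by case: p => x t; congr pair; exact: val_inj. Qed.

Section cons_measure.
Variables (n : nat) (mu : {sigma_finite_measure set (n.-tuple T) -> \bar R}).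

Definition cons_measure : set (n.+1.-tuple T) -> \bar R :=
  pushforward (@lebesgue_measure R \x mu)%E (@consp n).

Let cons_measure0 : cons_measure set0 = 0%E.
Proof. by rewrite /cons_measure /pushforward preimage_set0 measure0. Qed.

Let cons_measure_ge0 X : (0 <= cons_measure X)%E.
Proof. by rewrite /cons_measure /pushforward measure_ge0. Qed.

Let cons_measure_semi_sigma_additive : semi_sigma_additive cons_measure.
Proof.
have mE (X : set (n.+1.-tuple T)) : measurable X ->
    measurable (@consp n @^-1` X).
  by move=> mX; rewrite -[X in measurable X]setTI; exact: measurable_consp.
move=> F mF tF mUF; rewrite /cons_measure /pushforward preimage_bigcup.
apply: measure_semi_sigma_additive.
- by move=> k; exact: mE.
- apply/trivIsetP => i j _ _ ij; rewrite -preimage_setI.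
  by move/trivIsetP : tF => /(_ _ _ _ _ ij) ->//; rewrite preimage_set0.
- by rewrite -preimage_bigcup; exact: mE.
Qed.

HB.instance Definition _ := isMeasure.Build _ _ _ cons_measure
  cons_measure0 cons_measure_ge0 cons_measure_semi_sigma_additive.

Let cons_measure_sigma_finite : sigma_finite setT cons_measure.
Proof.
have /sigma_finiteP[F [FT ndF Foo]] := sigma_finiteT (@lebesgue_measure R).
have /sigma_finiteP[G [GT ndG Goo]] := sigma_finiteT mu.
exists (fun k => (fun t : n.+1.-tuple T =>
    (thead t, [tuple of behead t])) @^-1` (F k `*` G k)).
  rewrite -preimage_bigcup; apply/esym/seteqP; split => // t _.
  have [i _ Fi] : (\bigcup_i F i) (thead t) by rewrite -FT.
  have [j _ Gj] : (\bigcup_i G i) [tuple of behead t] by rewrite -GT.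
  exists (maxn i j) => //; split => /=.
  - by move: Fi; exact/subsetPset/ndF/leq_maxl.
  - by move: Gj; exact/subsetPset/ndG/leq_maxr.
move=> k; have [mF Fk] := Foo k; have [mG Gk] := Goo k; split.
  rewrite -[X in measurable X]setTI; apply: measurable_unconsp => //.
  exact: measurableX.
rewrite /cons_measure /pushforward.
rewrite (_ : _ @^-1` _ = F k `*` G k).
  by rewrite product_measure1E// lte_mul_pinfty// ge0_fin_numE.
by apply/funext => p; rewrite -[in RHS](conspK p).
Qed.

HB.instance Definition _ :=
  Measure_isSigmaFinite.Build _ _ _ cons_measure cons_measure_sigma_finite.

End cons_measure.

Fixpoint lebesgue_tuple (d : nat) :
    {sigma_finite_measure set (d.-tuple T) -> \bar R} :=
  match d with
  | 0%N => dirac ([tuple] : 0.-tuple T)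
  | n.+1 => cons_measure (lebesgue_tuple n)
  end.

End lebesgue_tuple.

Section distributions.
Variables (R : realType) (d : nat).
Local Notation V := 'cV[R]_d.
Local Notation C := R[i].

Definition colv (t : d.-tuple R) : V := \col_i tnth t i.

Definition dot (x y : V) : R := (x^T *m y) 0 0.

Definition rintegral (f : V -> R) : R :=
  \int[lebesgue_tuple d]_t f (colv t).

Definition cintegral (f : V -> C) : C :=
  rintegral (fun x => complex.Re (f x)) +i*
  rintegral (fun x => complex.Im (f x)).

(* [s] lists the coordinates along which one differentiates. *)
Fixpoint partial (s : seq 'I_d) (f : V -> R) : V -> R :=
  if s is i :: s' then fun x => 'D_(delta_mx i 0) (partial s' f) x else f.

Definition smoothR (f : V -> R) : Prop :=
  forall s, continuous (partial s f) /\
    forall i x, derivable (partial s f) x (delta_mx i 0).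

Definition smooth (f : V -> C) : Prop :=
  smoothR (fun x => complex.Re (f x)) /\ smoothR (fun x => complex.Im (f x)).

(* All Schwartz seminorms sup_x |x|^k |D^s f(x)| of order at most N (both in
   the weight and in the derivatives) are at most B. *)
Definition seminormsR_le (N : nat) (B : R) (f : V -> R) : Prop :=
  forall (k : nat) (s : seq 'I_d), (k <= N)%N -> (size s <= N)%N ->
    forall x, `|x| ^+ k * `|partial s f x| <= B.

Definition seminorms_le (N : nat) (B : R) (f : V -> C) : Prop :=
  seminormsR_le N B (fun x => complex.Re (f x)) /\
  seminormsR_le N B (fun x => complex.Im (f x)).

Definition schwartz (f : V -> C) : Prop :=
  smooth f /\ forall N, exists B, seminorms_le N B f.

(* Functionals are total on V -> C; only their values on Schwartz functions
   are meaningful. Continuity is continuity at 0 for the topology generated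
   by the seminorms. *)
Definition tempered_distribution (T : (V -> C) -> C) : Prop :=
  (forall (a : C) f g, schwartz f -> schwartz g ->
     T (fun x => a * f x + g x) = a * T f + T g) /\
  (forall e : R, 0 < e -> exists (N : nat) (B : R), 0 < B /\
     forall f, schwartz f -> seminorms_le N B f -> `|T f| <= e%:C).

(* The integral converges absolutely for Schwartz f when g is measurable with
   at most polynomial growth. *)
Definition regular_distribution (g : V -> C) (f : V -> C) : C :=
  cintegral (fun x => g x * f x).

Definition fourier (f : V -> C) (xi : V) : C :=
  cintegral (fun x => f x * (cos (dot xi x) -i* sin (dot xi x))).

Definition fourier_distribution (T : (V -> C) -> C) (f : V -> C) : C :=
  T (fourier f).

Definition tsupp (f : V -> C) : set V := closure [set x | f x != 0].

Definition vanishes_on (T : (V -> C) -> C) (U : set V) : Prop :=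
  forall f, smooth f -> compact (tsupp f) -> tsupp f `<=` U -> T f = 0.

Definition distribution_support (T : (V -> C) -> C) : set V :=
  ~` \bigcup_(U in [set U | open U /\ vanishes_on T U]) U.

Definition compactly_supported (T : (V -> C) -> C) : Prop :=
  compact (distribution_support T).

End distributions.

Section elliptic.
Variables (R : realType) (d : nat).
Local Notation V := 'cV[R]_d.

Definition real_isotropic_dilation (A : 'M[int]_d) : Prop :=
  let AC : 'M[R[i]]_d := map_mx intr A in
  [/\ forall a, eigenvalue AC a -> 1 < `|a|,
      diagonalizable AC &
      forall a b, eigenvalue AC a -> eigenvalue AC b -> `|a| = `|b|].

Definition symmetric_posdef (Q : 'M[R]_d) : Prop :=
  Q^T = Q /\ forall x : V, x != 0 -> 0 < (x^T *m Q *m x) 0 0.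

Definition orthogonal_mx (U : 'M[R]_d) : Prop := U^T *m U = 1%:M.

Variable A : 'M[int]_d.

Definition dil_q : R := `|(\det A)%:~R|.

(* A^{-T} *)
Definition invtr : 'M[R]_d := invmx (map_mx intr A)^T.

Definition elliptic_factor (Q : 'M[R]_d) : Prop :=
  symmetric_posdef Q /\
  exists2 U : 'M[R]_d, orthogonal_mx U &
    invtr = dil_q `^ (- d%:R^-1) *: (invmx Q *m U *m Q).

(* The set S(A^T); it is finite since det A != 0, so that the finitely
   supported product in [mask_m0] is the usual one. *)
Definition digits : set V :=
  [set s : V | (forall i, 0 <= s i 0 < 1) /\
           exists k : 'cV[int]_d, (map_mx intr A)^T *m s = map_mx intr k].

Definition two_pi_lattice : set V :=
  [set xi : V | exists k : 'cV[int]_d, xi = (2 * pi) *: map_mx intr k].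

Variable Q : 'M[R]_d.

Definition quadP (xi : V) : R := (xi^T *m (Q *m Q) *m xi) 0 0.

Definition trigG (xi : V) : R :=
  4 * \sum_(i < d) (Q *m Q) i i * sin (xi i 0 / 2) ^+ 2 +
  2 * \sum_(i < d) \sum_(j < d | (i < j)%N)
        (Q *m Q) i j * sin (xi i 0) * sin (xi j 0).

Definition mask_m0 (xi : V) : R :=
  \big[*%R/1]_(s \in digits `\ 0)
    (trigG (xi + (2 * pi) *: s) / trigG ((2 * pi) *: s)).

Definition mu_quotient (xi : V) : R :=
  dil_q `^ (2 / d%:R) * mask_m0 (invtr *m xi) * trigG (invtr *m xi) / trigG xi.

(* trigG vanishes exactly on the lattice, where the quotient is replaced by
   its limit over punctured neighbourhoods. *)
Definition mu (xi : V) : R :=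
  if `[< two_pi_lattice xi >] then lim (mu_quotient x @[x --> xi^'])
  else mu_quotient xi.

Definition prodM (xi : V) : R :=
  limn (fun n => \prod_(0 <= j < n) mu (iter j (mulmx invtr) xi)).

Definition phihat (xi : V) : R :=
  (if xi == 0 then 1 else trigG xi / quadP xi) * prodM xi.

(* phi is the tempered distribution with Fourier transform [phihat]. *)
Definition elliptic_scaling_function (phi : (V -> R[i]) -> R[i]) : Prop :=
  tempered_distribution phi /\
  forall f, schwartz f ->
    fourier_distribution phi f =
    regular_distribution (fun xi => (phihat xi)%:C) f.

End elliptic.

(* Main.v *)
Require Import Defs.
From HB Require Import structures.
From mathcomp Require Import all_boot all_order all_algebra.
From mathcomp Require Import all_classical all_reals all_analysis.
From mathcomp Require Import measurable_realfun complex.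
From mathcomp Require Import zify ring lra.

(** Write r = q^(-1/d) < 1 and B = A^{-T}. The mask m0 is a trigonometric
    polynomial with m0(0) = 1, so each partial product
    p_n(xi) = prod_(1 <= j <= n) m0(B^j xi) is one as well, and its frequencies
    are sums of terms of size O(r^j): for all n they stay in one ball |k| <= rho
    ([partial_prod_trigpoly]). A trigonometric polynomial is the Fourier
    transform of a combination of point masses at its frequencies. As p_n tends
    to the Fourier transform of phi, the distribution phi is a limit of
    measures carried by that ball.

    The limit is taken against test functions. Let f be smooth with compact
    support outside the ball. Fourier inversion ([inverse_fourier]) gives a
    Schwartz function g with fourier g = f, hence phi(f) is the integral of
    phihat g, which is the limit of the integrals of p_n g. The integral of g
    against a cosine of frequency k is a combination of f(k) and f(- k), so all
    these integrals vanish.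

    Three ingredients carry the argument.
    - Convergence ([cvg_phihat]). A^{-T} multiplies the norm of Q xi by exactly
      r (isotropy), so P(B xi) = r^2 P(xi), and the product of the values
      mu(B^j xi) telescopes ([prod_mu]): the n-th approximant of phihat is
      p_n(xi) (G / P)(B^n xi), where G / P tends to 1 at the origin. This works
      off the lattice 2 pi Z^d, a null set that contains all zeros of G.
    - Domination ([partial_prod_growth]). The p_n grow at most polynomially,
      uniformly in n: each application of xi |-> B xi costs a bounded factor
      and shrinks xi by r, and once |xi| <= 1 the remaining product is bounded.
    - Fourier inversion for test functions. It is proved for the real integrals
      osc f theta xi = int f(y) cos(theta + xi.y) dy: a real phase theta makes
      both differentiation in xi and integration by parts a shift of theta by
      pi / 2, and it makes products of cosines, Abel summation with the kernel
      exp(- a (|xi_1| + ... + |xi_d|)) and Fubini work without complex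
      arithmetic. *)

Set Implicit Arguments.
Unset Strict Implicit.
Unset Printing Implicit Defensive.
Import Order.TTheory GRing.Theory Num.Theory.
Import numFieldNormedType.Exports.

Local Open Scope classical_set_scope.
Local Open Scope ring_scope.

(** * Lebesgue measure on tuples *)

Section tuple_measure.
Variable R : realType.
Local Notation T := (measurableTypeR R).
Local Notation leb := (@lebesgue_measure R).

Local Open Scope ereal_scope.

Lemma measurable_EFin d (S : measurableType d) (g : S -> R) :
  measurable_fun setT g -> measurable_fun setT (fun x => (g x)%:E).
Proof. by move=> mg; exact/measurable_EFinP. Qed.

Lemma ge0_integral_tupleS n (f : n.+1.-tuple T -> \bar R) :
  measurable_fun setT f -> (forall t, 0 <= f t) ->
  \int[lebesgue_tuple n.+1]_t f t =
  \int[leb]_x \int[lebesgue_tuple n]_t f (consp (x, t)).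
Proof.
move=> mf f0.
transitivity (\int[(leb \x lebesgue_tuple n)%E]_p (f (consp p))).
  exact: (ge0_integral_pushforward (@measurable_consp R n)
    (leb \x lebesgue_tuple n)%E measurableT mf).
rewrite fubini_tonelli1//.
by apply: measurableT_comp => //; exact: measurable_consp.
Qed.

Lemma integral_tupleS n (f : n.+1.-tuple T -> \bar R) :
  (lebesgue_tuple n.+1).-integrable setT f ->
  \int[lebesgue_tuple n.+1]_t f t =
  \int[leb]_x \int[lebesgue_tuple n]_t f (consp (x, t)).
Proof.
move=> /[dup] If /integrableP[mf foo].
have mfc : measurable_fun setT (f \o @consp R n).
  by apply: measurableT_comp => //; exact: measurable_consp.
have Ifc : (leb \x lebesgue_tuple n)%E.-integrable setT (f \o @consp R n).
  apply/integrableP; split => //; move: foo; congr (_ < _).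
  apply: (ge0_integral_pushforward (@measurable_consp R n)
    (leb \x lebesgue_tuple n)%E measurableT) => //.
  exact: measurableT_comp.
transitivity (\int[(leb \x lebesgue_tuple n)%E]_p (f (consp p))).
  exact: (integral_pushforward (@measurable_consp R n) mf Ifc).
by rewrite -(integral12_prod_meas1 Ifc).
Qed.

Lemma integral_tuple0 (f : 0.-tuple T -> \bar R) :
  measurable_fun setT f ->
  \int[lebesgue_tuple 0]_t f t = f [tuple].
Proof. by move=> mf; rewrite /= integral_dirac// diracT mul1e. Qed.

(** Both sides define measures that agree on the intervals ]l, r], and these
    determine Lebesgue measure. *)
Lemma lebesgue_affine (a v : R) (f : T -> \bar R) : (0 < a)%R ->
  measurable_fun setT f -> (forall x, 0 <= f x) ->
  \int[leb]_x f x = a%:E * \int[leb]_x f (v + a * x)%R.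
Proof.
move=> a0 mf f0.
have a0' : (0 <= a)%R by exact: ltW.
pose phi : T -> T := fun x => (v + a * x)%R.
have mphi : measurable_fun setT phi.
  apply: measurable_funD => //; exact: measurable_funM.
pose an : {nonneg R} := NngNum a0'.
(* [PM'] is a measure only once it is given the measurability of [phi]. *)
pose PM' : {measure set T -> \bar R} := pushforward leb phi.
pose PM := PM' mphi.
have E : forall A, measurable A -> leb A = mscale an PM A.
  apply: lebesgue_measure_unique => X [[l r] _ <-] /=.
  rewrite lebesgue_measure_itv /= /mscale /PM /= /pushforward /=.
  have -> : phi @^-1` `]l, r] = `]((l - v) / a)%R, ((r - v) / a)%R]%classic.
    apply/seteqP; split => x /=; rewrite !in_itv /= /phi => /andP[h1 h2]; apply/andP; move: h1 h2; rewrite ltr_pdivrMr// ler_pdivlMr//.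
      by rewrite mulrC ltrBlDl lerBrDl.
    by rewrite mulrC ltrBlDl lerBrDl.
  rewrite lebesgue_measure_itv /= !lte_fin ltr_pM2r ?invr_gt0// ltrD2r.
  case: ifPn => _; last by rewrite mule0.
  rewrite -!EFinB -EFinM; congr (_%:E); field; exact: lt0r_neq0.
rewrite (eq_measure_integral (mscale an PM)) => [|A mA _]; last exact: E.
rewrite ge0_integral_mscale//=; congr (_ * _).
by rewrite ge0_integral_pushforward.
Qed.

Lemma tnth_consp0 n (x : T) (t : n.-tuple T) : tnth (consp (x, t)) ord0 = x.
Proof. by []. Qed.

Lemma tnth_conspS n (x : T) (t : n.-tuple T) i :
  tnth (consp (x, t)) (lift ord0 i) = tnth t i.
Proof. by rewrite /consp /= tnthS. Qed.

Definition affine_tuple n (a : R) (v : 'I_n -> R) (t : n.-tuple T) : n.-tuple T :=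
  [tuple (v i + a * tnth t i)%R | i < n].

Lemma measurable_affine_tuple n (a : R) (v : 'I_n -> R) :
  measurable_fun setT (affine_tuple a v).
Proof.
apply/measurable_fun_tnthP => i.
rewrite (_ : _ \o _ = fun t => (v i + a * tnth t i)%R).
  apply: measurable_funD => //; apply: measurable_funM => //.
  exact: measurable_tnth.
by apply/funext => t /=; rewrite tnth_mktuple.
Qed.

Lemma affine_tuple_consp n (a : R) (v : 'I_n.+1 -> R) (x : T) (t : n.-tuple T) :
  affine_tuple a v (consp (x, t)) =
  consp ((v ord0 + a * x)%R, affine_tuple a (fun i => v (lift ord0 i)) t).
Proof.
apply: eq_from_tnth => i; rewrite tnth_mktuple.
case: (unliftP ord0 i) => [j|] ->; last by rewrite !tnth_consp0.
by rewrite !tnth_conspS tnth_mktuple.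
Qed.

(** Tonelli splits off one coordinate at a time, to which the statement on the
    line applies. *)
Lemma lebesgue_tuple_affine n (a : R) (v : 'I_n -> R) (f : n.-tuple T -> \bar R) :
  (0 < a)%R -> measurable_fun setT f -> (forall t, 0 <= f t) ->
  \int[lebesgue_tuple n]_t f t =
  (a ^+ n)%:E * \int[lebesgue_tuple n]_t f (affine_tuple a v t).
Proof.
move=> a0; elim: n v f => [|n IH] v f mf f0.
  rewrite expr0 mul1e; apply: eq_integral => t _; congr f.
  by rewrite [t]tuple0 [RHS]tuple0.
have an0 : (0 <= a ^+ n)%R by apply/exprn_ge0/ltW.
have mfa (vv : 'I_n.+1 -> R) : measurable_fun setT (fun t => f (affine_tuple a vv t)).
  by apply: measurableT_comp => //; exact: measurable_affine_tuple.
have mfc : measurable_fun setT (f \o @consp R n).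
  by apply: measurableT_comp => //; exact: measurable_consp.
rewrite !ge0_integral_tupleS//.
pose H x := \int[lebesgue_tuple n]_t
  f (consp (x, affine_tuple a (fun i => v (lift ord0 i)) t)).
have mfca x : measurable_fun setT (fun t => f (consp (x, t))).
  exact: (measurableT_comp mfc (measurable_pair1 x)).
have mH : measurable_fun setT H.
  apply: (measurable_fun_fubini_tonelli_F (fun p =>
     f (consp (p.1, affine_tuple a (fun i => v (lift ord0 i)) p.2)))) => //.
  apply: (measurableT_comp mfc).
  apply/measurable_fun_pair => //=.
  by apply: measurableT_comp => //; exact: measurable_affine_tuple.
have H0 x : 0 <= H x by exact: integral_ge0.
transitivity ((a ^+ n)%:E * \int[leb]_x H x).
  rewrite -ge0_integralZl//; apply: eq_integral => x _.
  by rewrite (IH (fun i => v (lift ord0 i)) _ (mfca x)).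
rewrite (lebesgue_affine (v ord0) a0 mH H0).
rewrite muleA exprSr EFinM; congr (_ * _).
by apply: eq_integral => x _; apply: eq_integral => t _; rewrite affine_tuple_consp.
Qed.

Lemma measurable_tensor n (h : T -> R) : measurable_fun setT h ->
  measurable_fun setT (fun t : n.-tuple T => \prod_(i < n) h (tnth t i))%R.
Proof.
move=> mh; apply: measurable_prod => i _.
by apply: (measurableT_comp mh); exact: measurable_tnth.
Qed.

Lemma prod_consp n (h : T -> R) x (t : n.-tuple T) :
  (\prod_(i < n.+1) h (tnth (consp (x, t)) i) =
   h x * \prod_(i < n) h (tnth t i))%R.
Proof.
by rewrite big_ord_recl; congr (_ * _)%R; apply: eq_bigr => i _; rewrite tnth_conspS.
Qed.

Lemma sum_consp n (z : 'I_n.+1 -> R) x (t : n.-tuple T) :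
  (\sum_(i < n.+1) tnth (consp (x, t)) i * z i =
   x * z ord0 + \sum_(i < n) tnth t i * z (lift ord0 i))%R.
Proof.
by rewrite big_ord_recl; congr (_ + _)%R; apply: eq_bigr => i _; rewrite tnth_conspS.
Qed.

Lemma ge0_integral_tensor n (h : T -> R) c : measurable_fun setT h ->
  (forall x, 0 <= h x)%R -> \int[leb]_x (h x)%:E = c%:E ->
  \int[lebesgue_tuple n]_t (\prod_(i < n) h (tnth t i))%:E = (c ^+ n)%:E.
Proof.
move=> mh h0 hc; have hp m (t : m.-tuple T) : (0 <= \prod_(i < m) h (tnth t i))%R.
  by apply: prodr_ge0.
elim: n => [|n IH].
  rewrite integral_tuple0; first by rewrite big_ord0.
  by apply: measurable_EFin; exact: measurable_tensor.
rewrite ge0_integral_tupleS; last 2 first.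
- by apply: measurable_EFin; exact: measurable_tensor.
- by move=> t; rewrite lee_fin.
under eq_integral => x _.
  under eq_integral => t _ do rewrite prod_consp EFinM.
  rewrite ge0_integralZl ?lee_fin//; last 2 first.
  - by apply: measurable_EFin; exact: measurable_tensor.
  - by move=> t _; rewrite lee_fin.
  rewrite IH.
  over.
rewrite ge0_integralZr//; last 3 first.
- exact: measurable_EFin.
- by move=> x _; rewrite lee_fin.
- by rewrite lee_fin -[c]/(fine c%:E) exprn_ge0// -hc fine_ge0// integral_ge0// => x _; rewrite lee_fin.
by rewrite hc -EFinM exprS.
Qed.

Lemma integrable_tensor n (h : T -> R) : leb.-integrable setT (EFin \o h) ->
  (lebesgue_tuple n).-integrable setT
    (fun t : n.-tuple T => (\prod_(i < n) h (tnth t i))%:E).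
Proof.
move=> /[dup] Ih /integrableP[/measurable_EFinP mh hoo].
apply/integrableP; split; first by apply: measurable_EFin; exact: measurable_tensor.
under eq_integral => t _ do rewrite abse_EFin normr_prod.
rewrite (@ge0_integral_tensor n (fun x => `|h x|%R) (fine (\int[leb]_x `|(h x)%:E|))) ?ltry//.
  exact: measurableT_comp.
by rewrite fineK// ge0_fin_numE// integral_ge0.
Qed.

(** The coordinates that have been integrated are absorbed into the phase, which
    is why theta is arbitrary; for an even kernel the sine part of each
    one-dimensional integral cancels and the phase factors out. *)
Lemma integral_tensor_cos n (k : T -> R) (K : R -> R) (z : 'I_n -> R) theta :
  leb.-integrable setT (EFin \o k) ->
  (forall theta z, \int[leb]_x (k x * cos (theta + x * z))%:E =
                   (cos theta * K z)%:E) ->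
  \int[lebesgue_tuple n]_t
     (\prod_(i < n) k (tnth t i) * cos (theta + \sum_(i < n) tnth t i * z i))%:E =
  (cos theta * \prod_(i < n) K (z i))%:E.
Proof.
move=> Ik kK.
have mk : measurable_fun setT k by apply/measurable_EFinP; case/integrableP: Ik.
have mc m (y : 'I_m -> R) th : measurable_fun setT (fun t : m.-tuple T =>
    cos (th + \sum_(i < m) tnth t i * y i))%R.
  apply: (measurableT_comp (continuous_measurable_fun (@continuous_cos R))).
  apply: measurable_funD => //; apply: measurable_sum => i.
  apply: measurable_funM => //; exact: measurable_tnth.
elim: n z theta => [|n IH] z theta.
  rewrite integral_tuple0; last first.
    apply: measurable_EFin; apply: measurable_funM; [exact: measurable_tensor|exact: mc].
  by rewrite !big_ord0 mul1r mulr1 addr0.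
rewrite integral_tupleS; last first.
  apply: (le_integrable measurableT _ _ (integrable_tensor n.+1 Ik)) => //.
    apply: measurable_EFin; apply: measurable_funM; [exact: measurable_tensor|exact: mc].
  move=> t _; rewrite lee_fin normrM ler_piMr//.
  by rewrite ler_norml cos_geN1 cos_le1.
under eq_integral => x _.
  under eq_integral => t _.
    rewrite prod_consp sum_consp -mulrA EFinM addrA.
    over.
  rewrite integralZl//; last first.
    apply: (le_integrable measurableT _ _ (integrable_tensor n Ik)) => //.
      apply: measurable_EFin; apply: measurable_funM; [exact: measurable_tensor|exact: mc].
    move=> t _; rewrite lee_fin normrM ler_piMr//.
    by rewrite ler_norml cos_geN1 cos_le1.
  rewrite (IH (fun i => z (lift ord0 i)) (theta + x * z ord0)%R).
  rewrite -EFinM mulrA EFinM.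
  over.
have mc1 : measurable_fun setT (fun x : T => cos (theta + x * z ord0)).
  apply: (measurableT_comp (continuous_measurable_fun (@continuous_cos R))).
  by apply: measurable_funD => //; apply: measurable_funM.
rewrite integralZr//; last first.
  apply: (le_integrable measurableT _ _ Ik) => //.
    by apply: measurable_EFin; apply: measurable_funM.
  move=> t _; rewrite lee_fin normrM ler_piMr//.
  by rewrite ler_norml cos_geN1 cos_le1.
by rewrite kK -EFinM big_ord_recl mulrA.
Qed.

End tuple_measure.

(** * Column vectors *)

Section colvec.
Variables (R : realType) (d : nat).
Local Notation T := (measurableTypeR R).
Local Notation V := 'cV[R]_d.
Implicit Types x y xi : V.

Lemma dotE x y : dot x y = \sum_i x i 0 * y i 0.
Proof. by rewrite /dot mxE; apply: eq_bigr => i _; rewrite mxE. Qed.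

Lemma dotC x y : dot x y = dot y x.
Proof. by rewrite !dotE; apply: eq_bigr => i _; rewrite mulrC. Qed.

Lemma dotDr x y z : dot x (y + z) = dot x y + dot x z.
Proof. by rewrite /dot mulmxDr mxE. Qed.

Lemma dotDl x y z : dot (y + z) x = dot y x + dot z x.
Proof. by rewrite !(dotC _ x) dotDr. Qed.

Lemma dotZr a x y : dot x (a *: y) = a * dot x y.
Proof. by rewrite /dot -scalemxAr mxE. Qed.

Lemma dotZl a x y : dot (a *: x) y = a * dot x y.
Proof. by rewrite dotC dotZr dotC. Qed.

Lemma dotNr x y : dot x (- y) = - dot x y.
Proof. by rewrite -scaleN1r dotZr mulN1r. Qed.

Lemma dotBr x y z : dot x (y - z) = dot x y - dot x z.
Proof. by rewrite dotDr dotNr. Qed.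

Lemma dot0r x : dot x 0 = 0.
Proof. by rewrite /dot mulmx0 mxE. Qed.

Lemma dot_delta x i : dot x (delta_mx i 0) = x i 0.
Proof.
rewrite dotE (bigD1 i)//= !mxE !eqxx mulr1 big1 ?addr0// => j ji.
by rewrite mxE (negbTE ji) mulr0.
Qed.

Lemma coord_le_norm x i : `|x i 0| <= `|x|.
Proof. by rewrite [leRHS]mx_normrE; apply: (le_bigmax _ _ (i, 0)). Qed.

Lemma norm_le_coord x e : 0 <= e -> (forall i, `|x i 0| <= e) -> `|x| <= e.
Proof.
move=> e0 h; rewrite [leLHS]mx_normrE; apply/bigmax_leP; split => //= -[i j] _ /=.
by rewrite (ord1 j).
Qed.

Lemma norm_coord_ex x : 0 < `|x| -> exists i, `|x| = `|x i 0|.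
Proof.
move=> x0; have [] := @mx_norm_neq0 _ _ _ x.
  by rewrite -[X in X != _]/`|x| gt_eqF.
by move=> [i j] /= E; exists i; rewrite -(ord1 j).
Qed.

Lemma dot_le x y : `|dot x y| <= d%:R * `|x| * `|y|.
Proof.
rewrite dotE (le_trans (ler_norm_sum _ _ _))//.
apply: (le_trans (y := \sum_(i < d) `|x| * `|y|)).
  by apply: ler_sum => i _; rewrite normrM ler_pM// coord_le_norm.
by rewrite sumr_const card_ord -[leLHS]mulr_natl mulrA.
Qed.

Lemma continuous_coord i : continuous (fun x : V => x i 0).
Proof. exact: coord_continuous. Qed.

Lemma continuous_dotr x : continuous (dot x).
Proof.
have -> : dot x = fun y => \sum_i x i 0 * y i 0.
  by apply/funext => y; rewrite dotE.
apply: continuous_big => //= [|i _].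
  exact: add_continuous.
by move=> y; apply: continuousM; [exact: cst_continuous|exact: coord_continuous].
Qed.

Lemma vcontinuousD (f g : V -> R) : continuous f -> continuous g ->
  continuous (fun x => f x + g x).
Proof. by move=> cf cg x; apply: (@continuousD _ _ _ f g x); [exact: cf|exact: cg]. Qed.

Lemma vcontinuousM (f g : V -> R) : continuous f -> continuous g ->
  continuous (fun x => f x * g x).
Proof. by move=> cf cg x; apply: (@continuousM _ _ f g x); [exact: cf|exact: cg]. Qed.

Lemma vcontinuous_cst (a : R) : continuous (fun _ : V => a).
Proof. by move=> x; exact: cst_continuous. Qed.

Lemma vcontinuous_comp (h : R -> R) (f : V -> R) : continuous h -> continuous f ->
  continuous (fun x => h (f x)).
Proof. by move=> ch cf x; apply: (continuous_comp (f := f) (g := h)); [exact: cf|exact: ch]. Qed.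

Lemma tnth_colv (t : d.-tuple T) i : colv t i 0 = tnth t i.
Proof. by rewrite mxE. Qed.

Definition tuplev (x : V) : d.-tuple T := [tuple x i 0 | i < d].

Lemma tuplevK x : colv (tuplev x) = x.
Proof. by apply/colP => i; rewrite mxE tnth_mktuple. Qed.

Lemma colvK (t : d.-tuple T) : tuplev (colv t) = t.
Proof. by apply: eq_from_tnth => i; rewrite tnth_mktuple mxE. Qed.

Lemma measurable_coord i : measurable_fun setT (fun t : d.-tuple T => colv t i 0).
Proof.
by under eq_fun do rewrite tnth_colv; exact: measurable_tnth.
Qed.

Lemma measurable_eq_floor (n : nat) (k : int) :
  measurable [set x : T | Num.floor (n.+1%:R * x) = k].
Proof.
have -> : [set x : T | Num.floor (n.+1%:R * x) = k] =
    `[k%:~R / n.+1%:R, (k%:~R + 1) / n.+1%:R[%classic.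
  apply/seteqP; split => x /=; rewrite in_itv /= ler_pdivrMr// ltr_pdivlMr//
     ![x * _]mulrC.
    by move=> <-; have := mem_rg1_floor (n.+1%:R * x).
  move=> h; have /range1zP : range1 (k%:~R) (n.+1%:R * x) by exact: h.
  by rewrite RfloorE => /intr_inj.
exact: measurable_itv.
Qed.

(** F is the pointwise limit of its compositions with the rounding down of each
    coordinate to a multiple of 1 / (n + 1). These take countably many values,
    each of them on a box. *)
Lemma measurable_continuous (F : V -> R) : continuous F ->
  measurable_fun setT (fun t : d.-tuple T => F (colv t)).
Proof.
move=> cF.
pose fl n (t : d.-tuple T) : 'cV[int]_d := \col_i Num.floor (n.+1%:R * tnth t i).
pose st n (k : 'cV[int]_d) : V := \col_i ((k i 0)%:~R / n.+1%:R).
apply: (measurable_fun_cvg (h := fun n t => F (st n (fl n t)))).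
  move=> n _ B mB; rewrite setTI.
  have -> : (fun t => F (st n (fl n t))) @^-1` B =
      \bigcup_(k : 'cV[int]_d)
         ((if `[< B (F (st n k)) >] then setT else set0) `&` [set t | fl n t = k]).
    apply/seteqP; split => t /=.
      by move=> Bt; exists (fl n t) => //; split => //; case: asboolP.
    by move=> [k _ [h E]]; move: h; rewrite E; case: asboolP.
  apply: countable_bigcupT_measurable => [|k].
    exact: countableP.
  apply: measurableI; first by case: ifP.
  have -> : [set t | fl n t = k] =
     \bigcap_(i in [set: 'I_d]) ((@tnth _ T ^~ i) @^-1` [set x : T | Num.floor (n.+1%:R * x) = k i 0]).
    apply/seteqP; split => t /=.
      by move=> h i _ /=; rewrite -h mxE.
    by move=> h; apply/colP => i; rewrite mxE h.
  apply: fin_bigcap_measurable => // i _.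
  rewrite -[X in measurable X]setTI; apply: measurable_tnth => //.
  exact: measurable_eq_floor.
move=> t _; apply: (cvg_comp (fun n => st n (fl n t)) F (G := nbhs (colv t))); last exact: cF.
apply/cvgrPdist_le => e e0; near=> n.
apply: norm_le_coord => [|i]; first exact: ltW.
rewrite !mxE.
have /andP[h1 h2] := mem_rg1_floor (n.+1%:R * tnth t i).
have n0 : (0 : R) < n.+1%:R by [].
have E : tnth t i - (Num.floor (n.+1%:R * tnth t i))%:~R / n.+1%:R =
   (n.+1%:R * tnth t i - (Num.floor (n.+1%:R * tnth t i))%:~R) / n.+1%:R.
  by field; exact: lt0r_neq0.
rewrite E ger0_norm; last by rewrite divr_ge0// subr_ge0.
apply: (le_trans (y := n.+1%:R^-1)).
  by rewrite ler_piMl// lerBlDl ltW.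
near: n.
by have [N _ HN] := near_infty_natSinv_lt (PosNum e0); exists N => // n Nn; apply/ltW/HN.
Unshelve. all: by end_near. Qed.

End colvec.

(** * The Abel kernel on the line *)

Section abel_kernel.
Variable R : realType.
Local Notation T := (measurableTypeR R).
Local Notation leb := (@lebesgue_measure R).

(** The reflection turns ]l, r] into [- r, - l[, an interval of the same length. *)
Lemma lebesgue_opp (f : T -> \bar R) : measurable_fun setT f ->
  (forall x, (0 <= f x)%E) -> (\int[leb]_x f (- x)%R = \int[leb]_x f x)%E.
Proof.
move=> mf f0.
pose phi : T -> T := fun x => - x.
have mphi : measurable_fun setT phi by exact: measurableT_comp.
pose PM' : {measure set T -> \bar R} := pushforward leb phi.
pose PM := PM' mphi.
have E : forall A, measurable A -> leb A = PM A.
  apply: lebesgue_measure_unique => X [[l r] _ <-] /=.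
  rewrite lebesgue_measure_itv /= /PM /= /pushforward /=.
  have -> : phi @^-1` `]l, r] = `[(- r), (- l)[%classic.
    by apply/seteqP; split => x /=; rewrite !in_itv /= /phi lerNl ltrNr andbC.
  rewrite lebesgue_measure_itv /= !lte_fin ltrN2.
  by case: ifPn => // _; rewrite -!EFinB opprK addrC.
rewrite [RHS](eq_measure_integral PM) => [|A mA _]; last exact: E.
by rewrite ge0_integral_pushforward.
Qed.

Definition abel (a x : R) : R := expR (- (a * `|x|)).

Variable a : R.
Hypothesis a0 : 0 < a.

Lemma continuous_abel : continuous (abel a).
Proof.
move=> x; apply: (continuous_comp (f := fun x : R => - (a * `|x|)) (g := expR)).
  apply: continuousN; apply: continuousM; first exact: cst_continuous.
  exact: norm_continuous.
exact: continuous_expR.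
Qed.

Lemma continuous_cosM (z : R) : continuous (fun x : R => cos (x * z)).
Proof.
move=> x; apply: (continuous_comp (f := fun x : R => x * z) (g := @cos R)).
  by apply: continuousM; [exact: cvg_id|exact: cst_continuous].
exact: continuous_cos.
Qed.

Lemma continuous_sinM (z : R) : continuous (fun x : R => sin (x * z)).
Proof.
move=> x; apply: (continuous_comp (f := fun x : R => x * z) (g := @sin R)).
  by apply: continuousM; [exact: cvg_id|exact: cst_continuous].
exact: continuous_sin.
Qed.

Lemma cvg_expRN_y : expR (- (a * x)) @[x --> +oo] --> 0.
Proof.
apply/cvgrPdist_le => e e0; near=> x.
rewrite sub0r normrN ger0_norm ?expR_ge0// expRN -[e]invrK lef_pV2 ?posrE ?expR_gt0 ?invr_gt0//.
apply: (le_trans (y := 1 + a * x)); last exact: expR_ge1Dx.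
have : e^-1 / a <= x by near: x; apply: nbhs_pinfty_ge; rewrite num_real.
rewrite ler_pdivrMr// mulrC => h; apply: (le_trans h).
by rewrite lerDr.
Unshelve. all: by end_near. Qed.

Let F z (x : R) := expR (- (a * x)) *
  (- a^-1 + (z * sin (x * z) - a * cos (x * z)) / (a ^+ 2 + z ^+ 2)).

Let den z : a ^+ 2 + z ^+ 2 != 0.
Proof. by rewrite lt0r_neq0// ltr_wpDr ?sqr_ge0// exprn_gt0. Qed.

Let dF z (x : R) : is_derive x 1 (F z) (expR (- (a * x)) * (1 + cos (x * z))).
Proof.
rewrite /F.
apply: is_derive_eq.
rewrite /GRing.scale /=.
have D := den z; have A := lt0r_neq0 a0.
by field; rewrite D A.
Qed.

Let F_y z : F z x @[x --> +oo] --> 0.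
Proof.
pose M := a^-1 + (`|z| + a) / (a ^+ 2 + z ^+ 2).
have D0 : 0 < a ^+ 2 + z ^+ 2 by rewrite ltr_wpDr ?sqr_ge0// exprn_gt0.
have bF x : `|F z x| <= expR (- (a * x)) * M.
  rewrite /F normrM ger0_norm ?expR_ge0// ler_wpM2l ?expR_ge0//.
  rewrite (le_trans (ler_normD _ _))// lerD//.
    by rewrite normrN ger0_norm// invr_ge0 ltW.
  have Di : 0 < (a ^+ 2 + z ^+ 2)^-1 by rewrite invr_gt0.
  rewrite normrM (ger0_norm (ltW Di)) ler_pM2r// (le_trans (ler_normB _ _))// lerD// normrM.
    by rewrite ler_piMr// ler_norml sin_geN1 sin_le1.
  by rewrite (ger0_norm (ltW a0)) ler_piMr ?(ltW a0)// ler_norml cos_geN1 cos_le1.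
apply: (squeeze_cvgr (f := fun x => - (expR (- (a * x)) * M)) (h := fun x => expR (- (a * x)) * M)).
- by apply: nearW => x; rewrite -ler_norml.
- by rewrite -oppr0 -(mul0r M); apply: cvgN; apply: cvgMl; exact: cvg_expRN_y.
- by rewrite -(mul0r M); apply: cvgMl; exact: cvg_expRN_y.
Qed.

(** Adding 1 to the cosine makes the integrand nonnegative, as the improper form
    of the fundamental theorem of calculus requires. *)
Lemma integral_abel1cos z :
  (\int[leb]_x (abel a x * (1 + cos (x * z)))%:E =
   (2 * (a^-1 + a / (a ^+ 2 + z ^+ 2)))%:E)%E.
Proof.
have C : continuous (fun x : R => expR (- (a * x)) * (1 + cos (x * z))).
  have ce : continuous (fun x : R => expR (- (a * x))).
    move=> x; apply: (continuous_comp (f := fun x : R => - (a * x)) (g := expR)).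
      apply: continuousN; apply: continuousM; first exact: cst_continuous.
      exact: cvg_id.
    exact: continuous_expR.
  move=> x; apply: cvgM; first exact: ce.
  by apply: cvgD; [exact: cvg_cst|exact: continuous_cosM].
have Ca : continuous (fun x : R => abel a x * (1 + cos (x * z))).
  move=> x; apply: cvgM; first exact: continuous_abel.
  by apply: cvgD; [exact: cvg_cst|exact: continuous_cosM].
rewrite ge0_symfun_integralT; last 3 first.
- move=> x; rewrite mulr_ge0 ?expR_ge0// addrC -lerBlDr sub0r; exact: cos_geN1.
- exact: Ca.
- by move=> x /=; rewrite /abel normrN mulNr cosN.
rewrite EFinM; congr (_ * _)%E.
rewrite -set_itvcy.
under eq_integral => x.
  rewrite inE /= in_itv /= andbT => x0; rewrite /abel (ger0_norm x0).
  over.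
rewrite (ge0_continuous_FTC2y _ _ (@F_y z)).
- rewrite /F mulr0 oppr0 expR0 mul0r sin0 cos0 mul1r mulr0 sub0r mulr1.
  by rewrite -EFinB sub0r opprD opprK mulNr opprK.
- move=> x x0; rewrite mulr_ge0 ?expR_ge0// addrC -lerBlDr sub0r; exact: cos_geN1.
- exact: continuous_subspaceT.
- by move=> x _; have [] := dF z x.
- apply: cvg_at_right_filter.
  have [d1 _] := dF z 0.
  by have /differentiable_continuous := (derivable1_diffP _ _).1 d1.
- by move=> x _; rewrite derive1E; have [_ ->] := dF z x.
Qed.

Let pos1 (b : R) : -1 <= b -> 0 <= 1 + b.
Proof. by move=> h; rewrite addrC -lerBlDr sub0r. Qed.

Let mabel : measurable_fun setT (abel a).
Proof. by apply: continuous_measurable_fun; exact: continuous_abel. Qed.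

Let mcos z : measurable_fun setT (fun x : R => cos (x * z)).
Proof. by apply: continuous_measurable_fun; exact: continuous_cosM. Qed.

Let msin z : measurable_fun setT (fun x : R => sin (x * z)).
Proof. by apply: continuous_measurable_fun; exact: continuous_sinM. Qed.

Lemma integral_abel : (\int[leb]_x (abel a x)%:E = (2 / a)%:E)%E.
Proof.
have := integral_abel1cos 0.
under eq_integral => x _ do rewrite mulr0 cos0 mulrC EFinM.
rewrite ge0_integralZl_EFin//; last 2 first.
- by move=> x _; rewrite lee_fin expR_ge0.
- exact: measurable_EFin.
rewrite (_ : 2 * _ = 2 * (2 / a)); last first.
  by field; rewrite lt0r_neq0//= expr0n /= addr0 expf_neq0// lt0r_neq0.
rewrite [X in _ = X]EFinM => /(congr1 (mule 2^-1%:E)).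
rewrite muleA -!EFinM (_ : 2^-1 * (1 + 1) = 1 :> R); last by lra.
by rewrite mul1e => ->; congr (_%:E); field; exact: lt0r_neq0.
Qed.

Lemma integrable_abel : leb.-integrable setT (EFin \o abel a).
Proof.
apply/integrableP; split; first exact: measurable_EFin.
under eq_integral => x _ do rewrite abse_EFin /= ger0_norm ?expR_ge0//.
by rewrite integral_abel ltry.
Qed.

Let integrable_abelM (g : R -> R) : measurable_fun setT g ->
  (forall x, `|g x| <= 1) -> leb.-integrable setT (fun x => (abel a x * g x)%:E).
Proof.
move=> mg g1; apply: (le_integrable measurableT _ _ integrable_abel) => //.
  by apply: measurable_EFin; apply: measurable_funM.
by move=> x _; rewrite lee_fin normrM ler_piMr.
Qed.

Lemma integral_abel_cos z :
  (\int[leb]_x (abel a x * cos (x * z))%:E =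
   (2 * a / (a ^+ 2 + z ^+ 2))%:E)%E.
Proof.
have Ic : leb.-integrable setT (fun x => (abel a x * cos (x * z))%:E).
  by apply: integrable_abelM => // x; rewrite ler_norml cos_geN1 cos_le1.
have := integral_abel1cos z.
under eq_integral => x _ do rewrite mulrDr mulr1 EFinD.
rewrite integralD//; last exact: integrable_abel.
rewrite integral_abel -(fineK (integrable_fin_num measurableT Ic)) -EFinD => -[E].
congr (_%:E); have D := den z; have A := lt0r_neq0 a0.
apply: (addrI (2 / a)); rewrite E.
by field; rewrite D A.
Qed.

(** By the reflection x |-> - x, the integrals of abel a x (1 + sin (x z)) and
    abel a x (1 - sin (x z)) are equal. *)
Lemma integral_abel_sin z : (\int[leb]_x (abel a x * sin (x * z))%:E = 0)%E.
Proof.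
have Is y : leb.-integrable setT (fun x => (abel a x * sin (x * y))%:E).
  by apply: integrable_abelM => // x; rewrite ler_norml sin_geN1 sin_le1.
have E : (\int[leb]_x (abel a x * (1 + sin (x * z)))%:E =
          \int[leb]_x (abel a x * (1 - sin (x * z)))%:E)%E.
  rewrite -lebesgue_opp; last 2 first.
- apply: measurable_EFin; apply: measurable_funM => //.
  by apply: measurable_funD; [exact: measurable_cst|exact: msin].
  - by move=> x; rewrite lee_fin mulr_ge0 ?expR_ge0// pos1// sin_geN1.
  by apply: eq_integral => x _; rewrite /abel normrN mulNr sinN.
move: E.
under eq_integral => x _ do rewrite mulrDr mulr1 EFinD.
rewrite integralD//; last exact: integrable_abel.
under [in RHS]eq_integral => x _ do rewrite mulrBr mulr1 EFinB.
rewrite integralB//; last exact: integrable_abel.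
rewrite integral_abel -(fineK (integrable_fin_num measurableT (Is z))).
rewrite -EFinD -EFinB => -[E]; congr (_%:E).
lra.
Qed.

Lemma integral_abel_phase theta z :
  (\int[leb]_x (abel a x * cos (theta + x * z))%:E =
   (cos theta * (2 * a / (a ^+ 2 + z ^+ 2)))%:E)%E.
Proof.
have Is : leb.-integrable setT (fun x => (abel a x * sin (x * z))%:E).
  by apply: integrable_abelM => // x; rewrite ler_norml sin_geN1 sin_le1.
have Ic : leb.-integrable setT (fun x => (abel a x * cos (x * z))%:E).
  by apply: integrable_abelM => // x; rewrite ler_norml cos_geN1 cos_le1.
have Zl c (g : R -> R) : leb.-integrable setT (fun x => (g x)%:E) ->
    leb.-integrable setT (fun x => (c * g x)%:E).
  by move=> Ig; under eq_fun do rewrite EFinM; exact: integrableZl.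
under eq_integral => x _.
  rewrite cosD (_ : _ * _ = cos theta * (abel a x * cos (x * z)) -
     sin theta * (abel a x * sin (x * z))); last by ring.
  rewrite EFinB.
  over.
rewrite integralB//; [|exact: Zl|exact: Zl].
under eq_integral => x _ do rewrite EFinM.
rewrite integralZl// integral_abel_cos.
under eq_integral => x _ do rewrite EFinM.
by rewrite integralZl// integral_abel_sin mule0 sube0.
Qed.

End abel_kernel.

Lemma integral_cauchy (R : realType) :
  (\int[@lebesgue_measure R]_x ((1 + x ^+ 2)^-1)%:E = (@pi R)%:E)%E.
Proof.
rewrite ge0_symfun_integralT; last 3 first.
- by move=> x; rewrite invr_ge0 addr_ge0// sqr_ge0.
- exact: continuous_oneDsqrV.
- by move=> x /=; rewrite sqrrN.
rewrite -set_itvcy integral0y_oneDsqr -EFinM; congr (_%:E).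
by field.
Qed.

(** * Integration over column vectors *)

Section integration.
Variables (R : realType) (d : nat).
Local Notation T := (measurableTypeR R).
Local Notation V := 'cV[R]_d.
Local Notation mu := (@lebesgue_tuple R d).
Implicit Types (F G : V -> R).

Definition vmeasurable F := measurable_fun setT (fun t : d.-tuple T => F (colv t)).
Definition vintegrable F := mu.-integrable setT (fun t => (F (colv t))%:E).

Lemma vintegrable_measurable F : vintegrable F -> vmeasurable F.
Proof. by move=> /integrableP[/measurable_EFinP]. Qed.

Lemma eq_rintegral F G : F =1 G -> rintegral F = rintegral G.
Proof. by move=> FG; congr rintegral; apply/funext. Qed.

Lemma vintegrableD F G : vintegrable F -> vintegrable G ->
  vintegrable (fun x => F x + G x).
Proof.
by move=> IF IG; rewrite /vintegrable; under eq_fun do rewrite EFinD; exact: integrableD.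
Qed.

Lemma vintegrableZ a F : vintegrable F -> vintegrable (fun x => a * F x).
Proof.
by move=> IF; rewrite /vintegrable; under eq_fun do rewrite EFinM; exact: integrableZl.
Qed.

Lemma vintegrableB F G : vintegrable F -> vintegrable G ->
  vintegrable (fun x => F x - G x).
Proof.
by move=> IF IG; rewrite /vintegrable; under eq_fun do rewrite EFinB; exact: integrableB.
Qed.

Lemma vintegrable_norm F : vintegrable F -> vintegrable (fun x => `|F x|).
Proof. by move=> IF; exact: (integrable_norm IF). Qed.

Lemma rintegralD F G : vintegrable F -> vintegrable G ->
  rintegral (fun x => F x + G x) = rintegral F + rintegral G.
Proof. by move=> IF IG; rewrite /rintegral RintegralD. Qed.

Lemma rintegralB F G : vintegrable F -> vintegrable G ->
  rintegral (fun x => F x - G x) = rintegral F - rintegral G.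
Proof. by move=> IF IG; rewrite /rintegral RintegralB. Qed.

Lemma rintegralZ a F : vintegrable F -> rintegral (fun x => a * F x) = a * rintegral F.
Proof. by move=> IF; rewrite /rintegral RintegralZl. Qed.

Lemma rintegral0 : rintegral (fun _ : V => 0) = 0.
Proof. by rewrite /rintegral Rintegral_cst// mul0r. Qed.

Lemma vintegrable0 : vintegrable (fun _ => 0).
Proof. exact: integrable0. Qed.

Lemma vintegrable_sum (I : Type) (s : seq I) (F : I -> V -> R) :
  (forall i, vintegrable (F i)) -> vintegrable (fun x => \sum_(i <- s) F i x).
Proof.
move=> IF; elim: s => [|i s IH].
  by under eq_fun do rewrite big_nil; exact: vintegrable0.
by under eq_fun do rewrite big_cons; exact: vintegrableD.
Qed.

Lemma rintegral_sum (I : Type) (s : seq I) (F : I -> V -> R) :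
  (forall i, vintegrable (F i)) ->
  rintegral (fun x => \sum_(i <- s) F i x) = \sum_(i <- s) rintegral (F i).
Proof.
move=> IF; elim: s => [|i s IH].
  by rewrite big_nil -[RHS]rintegral0; apply: eq_rintegral => x; rewrite big_nil.
rewrite big_cons -IH -rintegralD//; last exact: vintegrable_sum.
by apply: eq_rintegral => x; rewrite big_cons.
Qed.

Lemma le_vintegrable F G : vmeasurable F -> (forall x, `|F x| <= G x) ->
  vintegrable G -> vintegrable F.
Proof.
move=> mF FG; apply: le_integrable => //; first exact: measurable_EFin.
by move=> t _; rewrite lee_fin (le_trans (FG _))// ler_norm.
Qed.

Lemma rintegral_ge0 F : (forall x, 0 <= F x) -> 0 <= rintegral F.
Proof. by move=> F0; apply: Rintegral_ge0. Qed.

Lemma le_rintegral F G : vintegrable F -> vintegrable G -> (forall x, F x <= G x) ->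
  rintegral F <= rintegral G.
Proof. by move=> IF IG FG; apply: le_Rintegral. Qed.

Lemma norm_rintegral F G : vmeasurable F -> vintegrable G ->
  (forall x, `|F x| <= G x) -> `|rintegral F| <= rintegral G.
Proof.
move=> mF IG FG; have IF := le_vintegrable mF FG IG.
rewrite (le_trans (le_normr_Rintegral measurableT IF))//.
exact: (le_rintegral (vintegrable_norm IF) IG FG).
Qed.

(** Convergence may fail on a null set N: the products that define phihat are
    controlled off the lattice 2 pi Z^d only. *)
Lemma rintegral_dominated (F_ : nat -> V -> R) F G (N : set (d.-tuple T)) :
  (forall n, vmeasurable (F_ n)) -> vmeasurable F ->
  measurable N -> mu N = 0%E ->
  (forall t, ~ N t -> F_ n (colv t) @[n --> \oo] --> F (colv t)) ->
  vintegrable G -> (forall n x, `|F_ n x| <= G x) ->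
  rintegral (F_ n) @[n --> \oo] --> rintegral F.
Proof.
move=> mF_ mF mN N0 cF IG bF.
have [IF _ cvgI] : [/\ vintegrable F,
    [sequence (\int[mu]_t `|(F_ n (colv t))%:E - (F (colv t))%:E|)%E]_n @ \oo --> 0%E &
    [sequence (\int[mu]_t (F_ n (colv t))%:E)%E]_n @ \oo --> (\int[mu]_t (F (colv t))%:E)%E].
  apply: (@dominated_convergence _ _ _ mu setT measurableT
     (fun n t => (F_ n (colv t))%:E) (fun t => (F (colv t))%:E)
     (fun t => (G (colv t))%:E)) => //.
  - by move=> n; apply: measurable_EFin; exact: mF_.
  - by apply: measurable_EFin; exact: mF.
  - exists N; split => // t /= H; apply: contrapT => Nt; apply: H => _.
    by apply: cvg_EFin; [exact: nearW|exact: cF].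
  - by apply: aeW => t n _; rewrite lee_fin.
have fin : (\int[mu]_t (F (colv t))%:E)%E \is a fin_num.
  exact: (integrable_fin_num measurableT IF).
rewrite -(fineK fin) in cvgI.
exact: (fine_cvg cvgI).
Qed.

Lemma rintegral_dominatedT (F_ : nat -> V -> R) F G :
  (forall n, vmeasurable (F_ n)) -> vmeasurable F ->
  (forall x, F_ n x @[n --> \oo] --> F x) ->
  vintegrable G -> (forall n x, `|F_ n x| <= G x) ->
  rintegral (F_ n) @[n --> \oo] --> rintegral F.
Proof.
move=> mF_ mF cF IG bF.
by apply: (rintegral_dominated (N := set0)) IG bF => //; rewrite measure0.
Qed.

Lemma colv_affine a (v : V) (t : d.-tuple T) :
  colv (affine_tuple a (fun i => v i 0) t) = v + a *: colv t.
Proof. by apply/colP => i; rewrite !mxE tnth_mktuple. Qed.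

Lemma vmeasurable_affine a (v : V) F : vmeasurable F ->
  vmeasurable (fun x => F (v + a *: x)).
Proof.
move=> mF; rewrite /vmeasurable; under eq_fun do rewrite -colv_affine.
by apply: (measurableT_comp mF); exact: measurable_affine_tuple.
Qed.

Let ge0_affine a (v : V) (F : V -> R) : 0 < a -> vmeasurable F ->
  (forall x, 0 <= F x) ->
  (\int[mu]_t (F (colv t))%:E =
   (a ^+ d)%:E * \int[mu]_t (F (v + a *: colv t))%:E)%E.
Proof.
move=> a0 mF F0.
rewrite (lebesgue_tuple_affine (fun i => v i 0) a0 (measurable_EFin mF)) => [|t].
  by under [in RHS]eq_integral do rewrite -colv_affine.
by rewrite lee_fin.
Qed.

Lemma vintegrable_affine a (v : V) F : 0 < a -> vintegrable F ->
  vintegrable (fun x => F (v + a *: x)).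
Proof.
move=> a0 IF; have mF := vintegrable_measurable IF.
apply/integrableP; split; first by apply: measurable_EFin; exact: vmeasurable_affine.
under eq_integral do rewrite abse_EFin.
rewrite (ge0_affine (- a^-1 *: v) (a := a^-1) (F := fun x => `|F (v + a *: x)|))//;
  last 2 first.
- by rewrite invr_gt0.
- by apply: measurableT_comp => //; exact: vmeasurable_affine.
rewrite lte_mul_pinfty ?lee_fin ?exprn_ge0 ?invr_ge0 ?ltW//.
move/integrableP : IF => [_]; congr (_ < _)%E; apply: eq_integral => t _ /=.
by rewrite scalerDr !scalerA mulrN divff ?lt0r_neq0// scaleN1r scale1r addrA subrr add0r.
Qed.

Lemma rintegral_affine a (v : V) F : 0 < a -> vintegrable F ->
  rintegral F = a ^+ d * rintegral (fun x => F (v + a *: x)).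
Proof.
move=> a0 IF; have mF := vintegrable_measurable IF.
(* The substitution holds for nonnegative functions, hence for both parts of F. *)
pose Fp x := Num.max (F x) 0; pose Fn x := Num.max (- F x) 0.
have FE x : F x = Fp x - Fn x.
  by rewrite /Fp /Fn; case: (leP (F x) 0) => h1; case: (leP (- F x) 0) => h2; lra.
have mp : vmeasurable Fp by exact: measurable_maxr.
have mn : vmeasurable Fn by apply: measurable_maxr => //; exact: measurableT_comp.
have Ip : vintegrable Fp.
  apply: (le_vintegrable mp _ (vintegrable_norm IF)) => x.
  by rewrite /Fp; case: (leP (F x) 0) => _; rewrite ?normr0 ?normr_ge0//.
have In : vintegrable Fn.
  apply: (le_vintegrable mn _ (vintegrable_norm IF)) => x.
  by rewrite /Fn; case: (leP (- F x) 0) => _; rewrite ?normr0 ?normrN ?normr_ge0//.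
have p0 x : 0 <= Fp x by rewrite /Fp le_max lexx orbT.
have n0 x : 0 <= Fn x by rewrite /Fn le_max lexx orbT.
have aux G : vintegrable G -> (forall x, 0 <= G x) ->
    rintegral G = a ^+ d * rintegral (fun x => G (v + a *: x)).
  move=> IG G0; rewrite /rintegral /Rintegral (ge0_affine v a0 (vintegrable_measurable IG) G0).
  by rewrite fineM//; apply: (integrable_fin_num measurableT (vintegrable_affine v a0 IG)).
rewrite (eq_rintegral FE) rintegralB// aux// [rintegral Fn]aux// -mulrBr -rintegralB;
  [|exact: vintegrable_affine|exact: vintegrable_affine].
by congr (_ * _); apply: eq_rintegral => x; rewrite -FE.
Qed.

Lemma rintegral_translate (v : V) F : vintegrable F ->
  rintegral (fun x => F (v + x)) = rintegral F.
Proof.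
move=> IF; rewrite (rintegral_affine v ltr01 IF) expr1n mul1r.
by apply: eq_rintegral => x; rewrite scale1r.
Qed.

Lemma rintegral_tensor (h : R -> R) c : measurable_fun setT h -> (forall x, 0 <= h x) ->
  (\int[@lebesgue_measure R]_x (h x)%:E = c%:E)%E ->
  vintegrable (fun x => \prod_i h (x i 0)) /\
  rintegral (fun x : V => \prod_i h (x i 0)) = c ^+ d.
Proof.
move=> mh h0 hc; split.
  rewrite /vintegrable.
  under eq_fun do under eq_bigr do rewrite tnth_colv.
  apply: integrable_tensor; apply/integrableP; split; first exact: measurable_EFin.
  by under eq_integral do rewrite abse_EFin ger0_norm//; rewrite hc ltry.
rewrite /rintegral /Rintegral.
under eq_integral do under eq_bigr do rewrite tnth_colv.
by rewrite (ge0_integral_tensor d mh h0 hc).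
Qed.

(** Up to the factor pi^d this is the density of d independent Cauchy variables;
    it is the integrable majorant of all the functions below. *)
Definition weight (x : V) : R := \prod_i (1 + x i 0 ^+ 2)^-1.

Lemma weight_ge0 x : 0 <= weight x.
Proof. by apply: prodr_ge0 => i _; rewrite invr_ge0 addr_ge0// sqr_ge0. Qed.

Lemma measurable_cauchy : measurable_fun setT (fun x : R => (1 + x ^+ 2)^-1).
Proof. by apply: continuous_measurable_fun; exact: continuous_oneDsqrV. Qed.

Let cauchy_ge0 (x : R) : 0 <= (1 + x ^+ 2)^-1.
Proof. by rewrite invr_ge0 addr_ge0// sqr_ge0. Qed.

Lemma vintegrable_weight : vintegrable weight.
Proof.
by have [] := rintegral_tensor measurable_cauchy cauchy_ge0 (integral_cauchy R).
Qed.

Lemma rintegral_weight : rintegral weight = pi ^+ d.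
Proof.
by have [] := rintegral_tensor measurable_cauchy cauchy_ge0 (integral_cauchy R).
Qed.

Lemma vintegrable_le_weight F C : vmeasurable F -> (forall x, `|F x| <= C * weight x) ->
  vintegrable F.
Proof. by move=> mF h; apply: (le_vintegrable mF h); exact/vintegrableZ/vintegrable_weight. Qed.

(** Decay faster than all powers of |x| thus implies domination by [weight]. *)
Lemma weight_lower x : (1 + `|x| ^+ 2) ^- d <= weight x.
Proof.
rewrite -exprVn -[X in _ ^+ X]card_ord -prodr_const; apply: ler_prod => i _.
rewrite invr_ge0 addr_ge0 ?sqr_ge0//= lef_pV2 ?posrE ?ltr_wpDr ?sqr_ge0//.
rewrite lerD2l -[leLHS]real_normK ?num_real// lerXn2r ?nnegrE//; exact: coord_le_norm.
Qed.

Definition vmeasurable2 (K : V -> V -> R) :=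
  measurable_fun setT (fun p : d.-tuple T * d.-tuple T => K (colv p.1) (colv p.2)).

Lemma rintegral_fubini (K : V -> V -> R) F G : vmeasurable2 K ->
  vintegrable F -> vintegrable G -> (forall x y, `|K x y| <= F x * G y) ->
  rintegral (fun x => rintegral (K x)) = rintegral (fun y => rintegral (fun x => K x y)).
Proof.
move=> mK IF IG KFG.
have IFG : (mu \x mu)%E.-integrable setT
    (fun p : d.-tuple T * d.-tuple T => (F (colv p.1) * G (colv p.2))%:E).
  apply/integrable12ltyP.
    apply: measurable_EFin; apply: measurable_funM.
      exact: (measurableT_comp (vintegrable_measurable IF)).
    exact: (measurableT_comp (vintegrable_measurable IG)).
  under eq_integral => x _.
    under eq_integral => y _ do rewrite /= normrM EFinM.
    rewrite ge0_integralZl//; last first.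
      by apply: measurable_EFin; exact: (vintegrable_measurable (vintegrable_norm IG)).
    rewrite -(fineK (integrable_fin_num measurableT (vintegrable_norm IG))).
    over.
  rewrite ge0_integralZr//; last 2 first.
  - by apply: measurable_EFin; exact: (vintegrable_measurable (vintegrable_norm IF)).
  - by rewrite lee_fin fine_ge0// integral_ge0.
  rewrite -(fineK (integrable_fin_num measurableT (vintegrable_norm IF))).
  by rewrite -EFinM ltry.
have IK : (mu \x mu)%E.-integrable setT
    (fun p : d.-tuple T * d.-tuple T => (K (colv p.1) (colv p.2))%:E).
  apply: (le_integrable measurableT _ _ IFG); first exact: measurable_EFin.
  by move=> p _; rewrite lee_fin (le_trans (KFG _ _))// ler_norm.
have K1 x : vintegrable (K x).
  apply: (le_vintegrable _ (KFG x)); last exact: vintegrableZ.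
  pose f (t : d.-tuple T) : d.-tuple T * d.-tuple T := (tuplev x, t).
  have mf : measurable_fun setT f by exact: measurable_pair1.
  have := measurableT_comp mK mf; congr measurable_fun.
  by apply/funext => t /=; rewrite tuplevK.
have K2 y : vintegrable (fun x => K x y).
  apply: (@le_vintegrable _ (fun x => G y * F x)); last exact: vintegrableZ.
    pose f (t : d.-tuple T) : d.-tuple T * d.-tuple T := (t, tuplev y).
    have mf : measurable_fun setT f by exact: measurable_pair2.
    have := measurableT_comp mK mf; congr measurable_fun.
    by apply/funext => t /=; rewrite tuplevK.
  by move=> x; rewrite mulrC.
have E1 x : (\int[mu]_t (K x (colv t))%:E)%E = (rintegral (K x))%:E.
  by rewrite /rintegral /Rintegral fineK//; exact: (integrable_fin_num measurableT (K1 x)).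
have E2 y : (\int[mu]_t (K (colv t) y)%:E)%E = (rintegral (fun x => K x y))%:E.
  by rewrite /rintegral /Rintegral fineK//; exact: (integrable_fin_num measurableT (K2 y)).
rewrite /rintegral /Rintegral; congr fine.
transitivity (\int[mu]_s \int[mu]_t (K (colv s) (colv t))%:E)%E.
  by apply: eq_integral => s _; rewrite E1.
rewrite (Fubini IK); apply: eq_integral => t _ /=; by rewrite E2.
Qed.

End integration.

(** * Derivatives and elementary estimates *)

Section real_estimates.
Variable R : realType.
Implicit Types (a b h x y : R) (f df : R -> R).

Lemma mean_value_le f df a b M : (forall x, is_derive x 1 f (df x)) ->
  (forall c, `|c - a| <= `|b - a| -> `|df c| <= M) -> `|f b - f a| <= M * `|b - a|.
Proof.
move=> fdf dfM.
have cf : continuous f.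
  move=> x; have [d1 _] := fdf x.
  exact: differentiable_continuous ((derivable1_diffP _ _).1 d1).
have [ab|ba|->] := ltgtP a b; last by rewrite !subrr !normr0 mulr0.
- have [|c] := @MVT_segment R f df a b (ltW ab) (fun x _ => fdf x).
    exact: continuous_subspaceT.
  rewrite in_itv /= => /andP[ac cb] ->; rewrite normrM ler_wpM2r//.
  by apply: dfM; rewrite !ger0_norm ?subr_ge0// ?lerD2r// (le_trans ac).
- have [|c] := @MVT_segment R f df b a (ltW ba) (fun x _ => fdf x).
    exact: continuous_subspaceT.
  rewrite in_itv /= => /andP[bc ca]; rewrite [in X in _ -> X]distrC => ->.
  rewrite normrM (distrC b) ler_wpM2r//; apply: dfM; rewrite distrC (distrC b).
  by rewrite !ger0_norm ?subr_ge0// ?(le_trans bc)// lerD2l lerN2.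
Qed.

Lemma norm_sin_le x : `|sin x| <= `|x|.
Proof.
have := @mean_value_le sin cos 0 x 1 (fun x => is_derive_sin x).
rewrite sin0 !subr0 mul1r; apply => c _.
by rewrite ler_norml cos_geN1 cos_le1.
Qed.

Lemma norm_cosB1_le x : `|cos x - 1| <= x ^+ 2.
Proof.
have := @mean_value_le cos (fun x => - sin x) 0 x `|x| (fun x => is_derive_cos x).
rewrite cos0 !subr0 -expr2 real_normK ?num_real//; apply => c h.
by move: h; rewrite subr0 normrN; exact: le_trans (norm_sin_le c).
Qed.

Lemma norm_sinB_le x : `|sin x - x| <= x ^+ 2.
Proof.
have := @mean_value_le (fun x => sin x - x) (fun x => cos x - 1) 0 x `|x|.
rewrite sin0 !subr0 -expr2 real_normK ?num_real//; apply => c h.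
have := @mean_value_le cos (fun x => - sin x) 0 c 1 (fun x => is_derive_cos x).
rewrite subr0 in h.
rewrite cos0 !subr0 mul1r => H; apply: le_trans h; apply: H => ? _.
by rewrite normrN ler_norml sin_geN1 sin_le1.
Qed.

Lemma norm_cosB_le x y : `|cos x - cos y| <= `|x - y|.
Proof.
have := @mean_value_le cos (fun x => - sin x) y x 1 (fun x => is_derive_cos x).
rewrite mul1r; apply => ? _.
by rewrite normrN ler_norml sin_geN1 sin_le1.
Qed.

Lemma cos_taylor_le a h : `|cos (a + h) - cos a + h * sin a| <= 2 * h ^+ 2.
Proof.
rewrite cosD [X in `|X|](_ : _ = cos a * (cos h - 1) - sin a * (sin h - h)); last by ring.
rewrite (le_trans (ler_normB _ _))// mulr_natl mulr2n !normrM lerD//.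
  rewrite -[leRHS]mul1r ler_pM ?norm_cosB1_le//.
  by rewrite ler_norml cos_geN1 cos_le1.
rewrite -[leRHS]mul1r ler_pM ?norm_sinB_le//.
by rewrite ler_norml sin_geN1 sin_le1.
Qed.

Lemma cosD_pihalf x : cos (x + pi / 2) = - sin x.
Proof. by rewrite cosD cos_pihalf sin_pihalf mulr0 mulr1 sub0r. Qed.

End real_estimates.

Section directional.
Variables (R : realType) (V : normedModType R).
Implicit Types (F : V -> R) (x v : V).

(** All derivatives that are computed by hand below are obtained from a quadratic
    bound on the remainder: for an integral with a parameter, such a bound is
    simply integrated. *)
Lemma is_derive_quadratic F x v l C :
  (forall h : R, `|F (h *: v + x) - F x - h * l| <= C * h ^+ 2) ->
  is_derive x v F l.
Proof.
move=> H.
have C0 : 0 <= C.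
  by have := le_trans (normr_ge0 _) (H 1); rewrite expr1n mulr1.
have L : h^-1 *: ((F \o shift x) (h *: v) - F x) @[h --> 0^'] --> l.
  apply/cvgrPdist_le => e e0; near=> h.
  have h0 : h != 0 by near: h; exact: nbhs_dnbhs_neq.
  have hn : 0 < `|h| by rewrite normr_gt0.
  rewrite /= /GRing.scale /= distrC.
  have -> : h^-1 * (F (h *: v + x) - F x) - l = h^-1 * (F (h *: v + x) - F x - h * l).
    by field.
  rewrite normrM normfV ler_pdivrMl// (le_trans (H h))//.
  rewrite -[h ^+ 2]real_normK ?num_real// expr2 mulrCA ler_pM2l//.
  apply: (le_trans (y := (C + 1) * `|h|)); first by rewrite ler_wpM2r// lerDl.
  rewrite mulrC -ler_pdivlMr ?ltr_wpDl//.
  near: h; apply: dnbhs0_le; apply: divr_gt0 => //; by rewrite ltr_wpDl.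
split; first by apply/cvg_ex; exists l.
exact: cvg_lim.
Unshelve. all: by end_near. Qed.

Lemma is_derive_line F dF x v : (forall y, is_derive y v F (dF y)) ->
  forall s : R, is_derive s 1 (fun s => F (s *: v + x)) (dF (s *: v + x)).
Proof.
move=> FdF s; have [D1 D2] := FdF (s *: v + x).
have E : (fun h : R => h^-1 *: (((fun s => F (s *: v + x)) \o shift s) (h *: 1) - F (s *: v + x))) =
   (fun h : R => h^-1 *: ((F \o shift (s *: v + x)) (h *: v) - F (s *: v + x))).
  apply/funext => h /=; congr (_ *: (F _ - _)).
  by rewrite -[h *: 1]/(h * 1) mulr1 scalerDl addrA.
by split; rewrite /derivable /derive E.
Qed.

Lemma mean_value_line F dF x v M : (forall y, is_derive y v F (dF y)) ->
  (forall y, `|dF y| <= M) -> forall h : R, `|F (h *: v + x) - F x| <= M * `|h|.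
Proof.
move=> FdF dFM h.
have := @mean_value_le R (fun s => F (s *: v + x)) (fun s => dF (s *: v + x)) 0 h M
  (is_derive_line x FdF).
by rewrite scale0r add0r subr0; apply.
Qed.

End directional.

Section cv_compact.
Variables (R : realType) (d : nat).
Local Notation V := 'cV[R]_d.

Lemma norm_trmx (x : 'rV[R]_d) : `|x^T| = `|x|.
Proof.
apply/eqP; rewrite eq_le; apply/andP; split.
  apply: norm_le_coord => // i; rewrite mxE [leRHS]mx_normrE.
  exact: (le_bigmax _ _ (0, i)).
rewrite [leLHS]mx_normrE; apply/bigmax_leP; split => //= -[i j] _ /=.
by rewrite (ord1 i) (le_trans _ (coord_le_norm _ j))// mxE.
Qed.

(** Transposition is an isometry onto the row vectors, for which the statement is
    known. *)
Lemma cV_bounded_closed_compact (A : set V) L :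
  (forall x, A x -> `|x| <= L) -> closed A -> compact A.
Proof.
move=> bA cA.
have ctr : continuous (fun x : 'rV[R]_d => x^T : V).
  move=> x B /nbhs_ballP[e /= e0 eB]; apply/nbhs_ballP; exists e => //= y [_ xy].
  by apply: eB; split => // i j; rewrite !mxE; exact: xy.
have -> : A = trmx @` (trmx @^-1` A : set 'rV[R]_d).
  apply/seteqP; split => x /=.
    by move=> Ax; exists x^T; rewrite trmxK.
  by move=> [y Ay <-].
apply: continuous_compact; first exact: continuous_subspaceT.
apply: bounded_closed_compact.
  exists L; split; first exact: num_real.
  by move=> M LM x /= /bA; rewrite norm_trmx => h; rewrite (le_trans h)// ltW.
by apply: closed_comp => // x _; exact: ctr.
Qed.

Lemma compact_norm_le (A : set V) : compact A -> exists L, forall x, A x -> `|x| <= L.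
Proof.
move=> /compact_bounded[M [_ H]]; exists (M + 1) => x Ax.
by apply: H => //; rewrite ltrDl.
Qed.

Lemma continuous_bounded_on_ball (f : V -> R) L : continuous f ->
  exists M, 0 <= M /\ forall x, `|x| <= L -> `|f x| <= M.
Proof.
move=> cf.
have cB : compact [set x : V | `|x| <= L].
  apply: (@cV_bounded_closed_compact _ L) => //.
  apply: (closed_comp (f := fun x : V => `|x|) (D := [set y : R | y <= L])) => [x _|].
    exact: norm_continuous.
  exact: closed_le.
have : compact (f @` [set x : V | `|x| <= L]).
  by apply: continuous_compact => //; exact: continuous_subspaceT.
move=> /compact_bounded[M [_ H]]; exists (`|M| + 1); split; first by rewrite addr_ge0.
move=> x xL; apply: (H (`|M| + 1)); first by rewrite ltr_pwDr// ler_norm.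
by exists x.
Qed.

End cv_compact.

(** * Test functions *)

Section test_functions.
Variables (R : realType) (d : nat).
Local Notation V := 'cV[R]_d.
Implicit Types (f g : V -> R) (x y xi : V) (s : seq 'I_d).

Local Notation e_ i := (delta_mx i 0 : V).

Lemma partial_cat s s' f : partial (s ++ s') f = partial s (partial s' f).
Proof. by elim: s => //= i s ->. Qed.

Lemma smoothR_continuous f : smoothR f -> continuous f.
Proof. by move=> /(_ [::]) []. Qed.

Lemma smoothR_is_derive f s i x : smoothR f ->
  is_derive x (e_ i) (partial s f) (partial (i :: s) f x).
Proof. by move=> /(_ s)[_ D]; exact: derivableP. Qed.

Lemma smoothR_partial f s : smoothR f -> smoothR (partial s f).
Proof. by move=> sf s'; rewrite -partial_cat; exact: sf. Qed.

Lemma is_derive_coord x i j : is_derive x (e_ i) (fun x : V => x j 0) (j == i)%:R.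
Proof.
apply: (@is_derive_quadratic _ _ _ _ _ _ 0) => h.
by rewrite mul0r !mxE eqxx andbT addrK subrr normr0.
Qed.

Lemma is_derive_seq_sum (I : Type) (r : seq I) (F dF : I -> V -> R) x v :
  (forall i, is_derive x v (F i) (dF i x)) ->
  is_derive x v (fun x => \sum_(i <- r) F i x) (\sum_(i <- r) dF i x).
Proof.
move=> FdF; elim: r => [|i r IH].
  rewrite big_nil (_ : (fun _ => _) = cst 0); first exact: is_derive_cst.
  by apply/funext => y; rewrite big_nil.
rewrite big_cons (_ : (fun _ => _) = F i \+ (fun x => \sum_(i <- r) F i x)).
  exact: is_deriveD.
by apply/funext => y; rewrite big_cons.
Qed.

(** All the ways to delete one occurrence of j from s: the terms of the Leibniz
    rule in which one differentiation is spent on the factor x_j. *)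
Fixpoint leibniz_terms (j : 'I_d) s : seq (seq 'I_d) :=
  if s is i :: s' then (if j == i then [:: s'] else [::]) ++ map (cons i) (leibniz_terms j s')
  else [::].

(** Both parts are proved together since the derivative at stage s is what yields
    the formula at stage i :: s. *)
Lemma partial_coordM f j s x : smoothR f ->
  partial s (fun x => x j 0 * f x) x =
    x j 0 * partial s f x + \sum_(s' <- leibniz_terms j s) partial s' f x
  /\ forall i, is_derive x (e_ i) (partial s (fun x => x j 0 * f x))
    (x j 0 * partial (i :: s) f x + \sum_(s' <- leibniz_terms j (i :: s)) partial s' f x).
Proof.
move=> sf.
have key s0 : (partial s0 (fun x => x j 0 * f x) =
    fun x => x j 0 * partial s0 f x + \sum_(s' <- leibniz_terms j s0) partial s' f x) ->
  forall y i, is_derive y (e_ i) (partial s0 (fun x => x j 0 * f x))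
    (y j 0 * partial (i :: s0) f y + \sum_(s' <- leibniz_terms j (i :: s0)) partial s' f y).
  move=> -> y i.
  have D1 := is_deriveM (is_derive_coord y i j) (smoothR_is_derive s0 i y sf).
  have D2 := @is_derive_seq_sum _ (leibniz_terms j s0) (fun s' => partial s' f)
     (fun s' => partial (i :: s') f) y (e_ i) (fun s' => smoothR_is_derive s' i y sf).
  refine (is_derive_eq (is_deriveD D1 D2) _).
  rewrite /GRing.scale /= big_cat big_map /= -addrA; congr (_ + _).
  by congr (_ + _); case: eqP => _; rewrite ?mulr1 ?mulr0 ?big_nil ?big_seq1.
have E s0 : partial s0 (fun x => x j 0 * f x) =
    fun x => x j 0 * partial s0 f x + \sum_(s' <- leibniz_terms j s0) partial s' f x.
  elim: s0 => [|i s0 IH]; apply/funext => y.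
    by rewrite /= big_nil addr0.
  have [_ /= E] := key s0 IH y i.
  by rewrite /= E.
split; first by rewrite E.
by move=> i; exact: key.
Qed.

Lemma continuous_seq_sum (I : Type) (r : seq I) (F : I -> V -> R) :
  (forall i, continuous (F i)) -> continuous (fun x => \sum_(i <- r) F i x).
Proof.
move=> cF; elim: r => [|i r IH].
  rewrite (_ : (fun _ => _) = fun=> 0); first by move=> x; exact: cst_continuous.
  by apply/funext => x; rewrite big_nil.
rewrite (_ : (fun _ => _) = fun x => F i x + \sum_(i <- r) F i x).
  exact: vcontinuousD (cF i) IH.
by apply/funext => x; rewrite big_cons.
Qed.

Lemma smoothR_coordM f j : smoothR f -> smoothR (fun x => x j 0 * f x).
Proof.
move=> sf s; split.
  rewrite (_ : partial s _ = fun x => x j 0 * partial s f x +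
      \sum_(s' <- leibniz_terms j s) partial s' f x); last first.
    by apply/funext => x; have [] := partial_coordM j s x sf.
  apply: vcontinuousD.
    by apply: vcontinuousM; [exact: continuous_coord|exact: (sf s).1].
  by apply: continuous_seq_sum => s'; exact: (sf s').1.
by move=> i x; have [_ /(_ i) []] := partial_coordM j s x sf.
Qed.

Definition cont_compact f := continuous f /\ exists L, forall x, L < `|x| -> f x = 0.

Definition testfn f := smoothR f /\ exists L, forall x, L < `|x| -> f x = 0.

Lemma testfn_cont_compact f : testfn f -> cont_compact f.
Proof. by move=> [/smoothR_continuous]. Qed.

Lemma testfn_coordM f j : testfn f -> testfn (fun x => x j 0 * f x).
Proof.
move=> [sf [L fL]]; split; first exact: smoothR_coordM.
by exists L => x /fL ->; rewrite mulr0.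
Qed.

Lemma testfn_partial f i : testfn f -> testfn (partial [:: i] f).
Proof.
move=> [sf [L fL]]; split; first exact: smoothR_partial.
exists L => x xL /=.
have N : nbhs x [set y : V | L < `|y|].
  apply: open_nbhs_nbhs; split => //.
  apply: (open_comp (f := fun y : V => `|y|) (D := [set r : R | L < r])) => [y _|].
    exact: norm_continuous.
  exact: open_gt.
rewrite (@near_eq_derive _ _ _ f (cst 0)) ?derive_cst//.
by apply: filterS N => y /= /fL.
Qed.

Lemma testfnZ f a : testfn f -> testfn (fun x => a * f x).
Proof.
move=> [sf [L fL]]; split; last by exists L => x /fL ->; rewrite mulr0.
have E s x : partial s (fun x => a * f x) x = a * partial s f x /\
    forall i, is_derive x (e_ i) (partial s (fun x => a * f x)) (a * partial (i :: s) f x).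
  have key s0 : partial s0 (fun x => a * f x) = (fun x => a * partial s0 f x) ->
      forall y i, is_derive y (e_ i) (partial s0 (fun x => a * f x)) (a * partial (i :: s0) f y).
    by move=> -> y i; have := is_deriveZ a (smoothR_is_derive s0 i y sf).
  have Es s0 : partial s0 (fun x => a * f x) = (fun x => a * partial s0 f x).
    elim: s0 => [//|i s0 IH]; apply/funext => y /=.
    by have [_ /= ->] := key s0 IH y i.
  by split; [rewrite Es|move=> i; exact: key].
move=> s; split; last by move=> i x; have [_ /(_ i) []] := E s x.
rewrite (_ : partial s _ = fun x => a * partial s f x).
  by apply: vcontinuousM; [exact: vcontinuous_cst|exact: (sf s).1].
by apply/funext => x; have [] := E s x.
Qed.

Lemma cont_compactM f g : continuous g -> cont_compact f -> cont_compact (fun x => g x * f x).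
Proof.
move=> cg [cf [L fL]]; split; last by exists L => x /fL ->; rewrite mulr0.
exact: vcontinuousM.
Qed.

Lemma bounded_support_weight f L M : 0 <= M -> (forall x, `|x| <= L -> `|f x| <= M) ->
  (forall x, L < `|x| -> f x = 0) ->
  forall x, `|f x| <= M * (1 + L ^+ 2) ^+ d * weight x.
Proof.
move=> M0 fM fL x; have [xL|xL] := leP `|x| L; last first.
  rewrite fL// normr0 !mulr_ge0 ?weight_ge0//.
  by rewrite exprn_ge0// addr_ge0// sqr_ge0.
rewrite (le_trans (fM x xL))// -mulrA ler_peMr//.
have P : 0 < (1 + L ^+ 2) ^+ d by rewrite exprn_gt0// ltr_wpDr ?sqr_ge0.
rewrite mulrC -ler_pdivrMr// div1r (le_trans _ (weight_lower x))//.
rewrite lef_pV2 ?posrE// ?exprn_gt0// ?ltr_wpDr ?sqr_ge0//.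
rewrite lerXn2r ?nnegrE ?addr_ge0 ?sqr_ge0// lerD2l lerXn2r ?nnegrE//.
by rewrite (le_trans _ xL).
Qed.

Lemma cont_compact_weight f : cont_compact f ->
  exists C, 0 <= C /\ forall x, `|f x| <= C * weight x.
Proof.
move=> [cf [L fL]]; have [M [M0 fM]] := continuous_bounded_on_ball L cf.
exists (M * (1 + L ^+ 2) ^+ d); split; last exact: bounded_support_weight.
by rewrite mulr_ge0// exprn_ge0// addr_ge0// sqr_ge0.
Qed.

Lemma cont_compact_bounded f : cont_compact f -> exists C, forall x, `|f x| <= C.
Proof.
move=> [cf [L fL]]; have [M [M0 fM]] := continuous_bounded_on_ball L cf.
by exists M => x; have [/fM//|/fL ->] := leP `|x| L; rewrite normr0.
Qed.

Lemma cont_compact_vintegrable f : cont_compact f -> vintegrable f.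
Proof.
move=> /[dup] -[cf _] /cont_compact_weight[C [_ H]].
by apply: vintegrable_le_weight H; exact: measurable_continuous.
Qed.

End test_functions.

(** * Oscillatory integrals *)

Section oscillatory.
Variables (R : realType) (d : nat).
Local Notation V := 'cV[R]_d.
Implicit Types (f g F : V -> R) (x y xi : V) (s : seq 'I_d).

Local Notation e_ i := (delta_mx i 0 : V).

Lemma norm_delta_le1 i : `|e_ i| <= 1.
Proof.
apply: norm_le_coord => // j; rewrite mxE; case: (_ && _); first by rewrite normr1.
by rewrite normr0.
Qed.

Lemma cvg_natSinv_dnbhs : (fun n => n.+1%:R^-1 : R) @ \oo --> (0 : R)^'.
Proof.
move=> A; rewrite /dnbhs /within /= => NA.
have H : \forall n \near \oo, harmonic n != 0 :> R -> A (harmonic n).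
  exact: (@cvg_harmonic R _ NA).
apply: (filterS _ H) => n; apply.
by rewrite /harmonic /= invr_eq0 pnatr_eq0.
Qed.

(** The difference quotients of F have integral zero by translation invariance.
    They converge to dF, and the mean value theorem bounds them. *)
Lemma rintegral_derive F dF i : (forall x, is_derive x (e_ i) F (dF x)) ->
  cont_compact F -> cont_compact dF -> rintegral dF = 0.
Proof.
move=> FdF cF cdF.
have [M dFM] := cont_compact_bounded cdF.
have M0 : 0 <= M by exact: le_trans (normr_ge0 _) (dFM 0).
have [L FL] := cF.2.
pose h n : R := n.+1%:R^-1.
have h0 n : 0 < h n by rewrite invr_gt0.
have h1 n : h n <= 1 by rewrite invf_le1 ?ler1n.
pose F_ n x := (h n)^-1 * (F (h n *: e_ i + x) - F x).
have IF := cont_compact_vintegrable cF.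
have ITF n : vintegrable (fun x => F (h n *: e_ i + x)).
  have := vintegrable_affine (h n *: e_ i) ltr01 IF.
  by under eq_fun do rewrite scale1r.
have F_0 n : rintegral (F_ n) = 0.
  rewrite rintegralZ; last exact: vintegrableB.
  by rewrite rintegralB// rintegral_translate// subrr mulr0.
have : rintegral (F_ n) @[n --> \oo] --> rintegral dF.
  apply: (@rintegral_dominatedT _ _ _ _ (fun x => M * (1 + (L + 1) ^+ 2) ^+ d * weight x)).
  - by move=> n; apply: vintegrable_measurable; apply: vintegrableZ; exact: vintegrableB.
  - by apply: measurable_continuous; exact: cdF.1.
  - move=> x; have [D1 D2] := FdF x.
    have : (fun h0 : R => h0^-1 *: ((F \o shift x) (h0 *: e_ i) - F x)) @ 0^' --> dF x.
      by rewrite -D2.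
    exact: (cvg_comp _ _ cvg_natSinv_dnbhs).
  - by apply: vintegrableZ; exact: vintegrable_weight.
  - move=> n; apply: bounded_support_weight => // x xL.
      have hi : 0 <= (h n)^-1 by rewrite invr_ge0 ltW.
      rewrite /F_ normrM (ger0_norm hi) ler_pdivrMl// mulrC.
      have := mean_value_line x FdF dFM (h n).
      by rewrite (ger0_norm (ltW (h0 n))).
    rewrite /F_ !FL ?subrr ?mulr0//; first by rewrite (lt_trans _ xL)// ltrDl.
    rewrite -[X in X < _](addrK 1) ltrBlDr (lt_le_trans xL)//.
    rewrite -[x in leLHS](addKr (h n *: e_ i)) (le_trans (ler_normD _ _))//.
    rewrite addrC lerD// normrN normrZ (ger0_norm (ltW (h0 n))).
    by apply: mulr_ile1 => //; [exact: ltW|exact: norm_delta_le1].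
under eq_fun do rewrite F_0.
by move=> /cvg_lim <- //; rewrite lim_cst.
Qed.

(** The phases 0 and - pi / 2 give the real and the imaginary part of the inverse
    Fourier integral. *)
Definition osc f theta xi := rintegral (fun y => f y * cos (theta + dot xi y)).

Lemma continuous_phase theta xi : continuous (fun y => cos (theta + dot xi y)).
Proof.
apply: vcontinuous_comp; first exact: continuous_cos.
by apply: vcontinuousD; [exact: vcontinuous_cst|exact: continuous_dotr].
Qed.

Lemma cont_compact_phase f theta xi : cont_compact f ->
  cont_compact (fun y => f y * cos (theta + dot xi y)).
Proof.
move=> cf; have := cont_compactM (@continuous_phase theta xi) cf.
by under eq_fun do rewrite mulrC.
Qed.

Lemma norm_cos_le1 (x : R) : `|cos x| <= 1.
Proof. by rewrite ler_norml cos_geN1 cos_le1. Qed.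

Lemma cont_compact_vintegrable_phase f theta xi : cont_compact f ->
  vintegrable (fun y => f y * cos (theta + dot xi y)).
Proof. by move=> cf; apply: cont_compact_vintegrable; exact: cont_compact_phase. Qed.

Lemma norm_osc_le f theta xi : cont_compact f ->
  `|osc f theta xi| <= rintegral (fun y => `|f y|).
Proof.
move=> cf; apply: norm_rintegral.
- by apply: vintegrable_measurable; exact: cont_compact_vintegrable_phase.
- by apply: vintegrable_norm; exact: cont_compact_vintegrable.
- by move=> x; rewrite normrM ler_piMr// norm_cos_le1.
Qed.

(** Since - sin a = cos (a + pi / 2), differentiation shifts the phase. *)
Lemma is_derive_phase theta xi i y :
  is_derive y (e_ i) (fun y => cos (theta + dot xi y)) (xi i 0 * cos (theta + pi / 2 + dot xi y)).
Proof.
apply: (@is_derive_quadratic _ _ _ _ _ _ (2 * xi i 0 ^+ 2)) => h.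
rewrite dotDr dotZr dot_delta.
have T := cos_taylor_le (theta + dot xi y) (h * xi i 0).
rewrite (addrAC theta) cosD_pihalf.
rewrite (_ : theta + (h * _ + _) = theta + dot xi y + h * xi i 0); last by ring.
rewrite (_ : _ - _ - _ = cos (theta + dot xi y + h * xi i 0) - cos (theta + dot xi y) +
  h * xi i 0 * sin (theta + dot xi y)); last by ring.
by rewrite (le_trans T)// exprMn le_eqVlt; apply/orP; left; apply/eqP; ring.
Qed.

(** Integration by parts: the derivative of f y * cos (theta - pi / 2 + xi.y)
    along the i-th axis has integral zero. *)
Lemma osc_partial f theta xi i : testfn f ->
  xi i 0 * osc f theta xi = - osc (partial [:: i] f) (theta - pi / 2) xi.
Proof.
move=> tf; have tdf := testfn_partial i tf.
have cf := testfn_cont_compact tf; have cdf := testfn_cont_compact tdf.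
(* With this phase, the derivative of the cosine has phase [theta]. *)
pose th := theta - pi / 2.
have D y : is_derive y (e_ i) (fun y => f y * cos (th + dot xi y))
    (partial [:: i] f y * cos (th + dot xi y) + xi i 0 * (f y * cos (theta + dot xi y))).
  have := is_deriveM (smoothR_is_derive [::] i y tf.1) (is_derive_phase th xi i y).
  move=> H; refine (is_derive_eq H _); rewrite /GRing.scale /= /th subrK.
  by rewrite addrC mulrC; congr (_ + _); ring.
have cx : cont_compact (fun y => xi i 0 * (f y * cos (theta + dot xi y))).
  by apply: cont_compactM; [exact: vcontinuous_cst|exact: cont_compact_phase].
have := rintegral_derive D (cont_compact_phase th xi cf) _.
rewrite rintegralD; [|exact: cont_compact_vintegrable_phase|exact: cont_compact_vintegrable].
rewrite rintegralZ; last exact: cont_compact_vintegrable_phase.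
move=> /(_ _)/eqP; rewrite addrC addr_eq0 => H; apply/eqP; apply: H.
have [c1 [L1 H1]] := cont_compact_phase th xi cdf.
have [c2 [L2 H2]] := cx.
split; first exact: vcontinuousD.
exists (Num.max L1 L2) => y; rewrite gt_max => /andP[y1 y2].
by rewrite H1// H2// addr0.
Qed.

(** [osc_partial] is iterated along an axis i on which |xi| is attained. The bound
    is an L1 norm of a derivative of f, so it does not depend on the phase. *)
Lemma osc_decay f : testfn f -> forall N, exists B, 0 <= B /\
  forall theta xi, (1 + `|xi|) ^+ N * `|osc f theta xi| <= B.
Proof.
move=> tf N.
have H i k : forall f, testfn f -> exists B, 0 <= B /\
    forall theta xi, `|xi i 0| ^+ k * `|osc f theta xi| <= B.
  elim: k => [|k IH] {tf}f tf.
    exists (rintegral (fun y => `|f y|)); split; first exact: rintegral_ge0.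
    by move=> theta xi; rewrite expr0 mul1r norm_osc_le//; exact: testfn_cont_compact.
  have [B [B0 HB]] := IH _ (testfn_partial i tf); exists B; split => // theta xi.
  by rewrite exprSr -mulrA -normrM osc_partial// normrN.
have /choice[B HB] : forall i, exists B, 0 <= B /\
    forall theta xi, `|xi i 0| ^+ N * `|osc f theta xi| <= B by move=> i; exact: H.
pose C := rintegral (fun y => `|f y|).
have C0 : 0 <= C by exact: rintegral_ge0.
exists (2 ^+ N * (C + \sum_i B i)); split.
  by rewrite mulr_ge0// ?exprn_ge0// addr_ge0// sumr_ge0// => i _; have [] := HB i.
move=> theta xi.
have oC : `|osc f theta xi| <= C by apply: norm_osc_le; exact: testfn_cont_compact.
have S0 : 0 <= \sum_i B i by rewrite sumr_ge0// => i _; have [] := HB i.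
have [x1|x1] := leP `|xi| 1.
  rewrite ler_pM ?exprn_ge0 ?addr_ge0//.
    by rewrite lerXn2r ?nnegrE ?addr_ge0//; lra.
  by rewrite (le_trans oC)// lerDl.
apply: (le_trans (y := (2 * `|xi|) ^+ N * `|osc f theta xi|)).
  by rewrite ler_wpM2r// lerXn2r ?nnegrE ?addr_ge0 ?mulr_ge0//; lra.
rewrite exprMn -mulrA ler_wpM2l ?exprn_ge0//.
have [i ->] := norm_coord_ex (lt_trans ltr01 x1).
rewrite (le_trans ((HB i).2 theta xi))// (bigD1 i)//= addrCA lerDl addr_ge0//.
by rewrite sumr_ge0// => j _; have [] := HB j.
Qed.

Lemma continuous_osc f theta : testfn f -> continuous (osc f theta).
Proof.
move=> tf xi; have cf := testfn_cont_compact tf.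
pose C := rintegral (fun y => d%:R * `|y| * `|f y|).
have C0 : 0 <= C by apply: rintegral_ge0 => y; rewrite !mulr_ge0.
have I : vintegrable (fun y => d%:R * `|y| * `|f y|).
  have cn : continuous (fun y : V => d%:R * `|y|).
    by apply: vcontinuousM; [exact: vcontinuous_cst|exact: norm_continuous].
  have := vintegrable_norm (cont_compact_vintegrable (cont_compactM cn cf)).
  by under eq_fun do rewrite !normrM normr_id ger0_norm//.
have lip z : `|osc f theta xi - osc f theta z| <= C * `|xi - z|.
  rewrite -rintegralB; [|exact: cont_compact_vintegrable_phase..].
  rewrite mulrC -rintegralZ//; apply: norm_rintegral.
  - by apply: vintegrable_measurable; apply: vintegrableB; exact: cont_compact_vintegrable_phase.
  - exact: vintegrableZ.
  move=> y; rewrite -mulrBr normrM mulrC mulrA ler_wpM2r//.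
  rewrite (le_trans (norm_cosB_le _ _))// opprD addrACA subrr add0r.
  rewrite !(dotC _ y) -dotBr (le_trans (dot_le _ _))//.
  by rewrite mulrC.
move=> A /nbhs_ballP[e /= e0 eA]; apply/nbhs_ballP.
have C1 : 0 < C + 1 by rewrite ltr_wpDl.
exists (e / (C + 1)) => /=; first exact: divr_gt0.
move=> z; rewrite -ball_normE /= => xz; apply: eA; rewrite -ball_normE /=.
apply: (le_lt_trans (lip z)).
apply: (le_lt_trans (y := (C + 1) * `|xi - z|)); first by rewrite ler_wpM2r// lerDl.
by rewrite mulrC -ltr_pdivlMr.
Qed.

Lemma is_derive_osc f theta xi i : testfn f ->
  is_derive xi (e_ i) (osc f theta) (osc (fun y => y i 0 * f y) (theta + pi / 2) xi).
Proof.
move=> tf; have cf := testfn_cont_compact tf.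
have cxf := testfn_cont_compact (testfn_coordM i tf).
have cxxf := testfn_cont_compact (testfn_coordM i (testfn_coordM i tf)).
apply: (@is_derive_quadratic _ _ _ _ _ _
   (2 * rintegral (fun y => `|y i 0 * (y i 0 * f y)|))) => h.
rewrite /osc -rintegralB; [|exact: cont_compact_vintegrable_phase..].
rewrite -rintegralZ; last exact: cont_compact_vintegrable_phase.
rewrite -rintegralB; last 2 first.
- by apply: vintegrableB; exact: cont_compact_vintegrable_phase.
- by apply: vintegrableZ; exact: cont_compact_vintegrable_phase.
have In := vintegrable_norm (cont_compact_vintegrable cxxf).
rewrite mulrAC -rintegralZ//; apply: norm_rintegral.
- apply: vintegrable_measurable; apply: vintegrableB.
    by apply: vintegrableB; exact: cont_compact_vintegrable_phase.
  by apply: vintegrableZ; exact: cont_compact_vintegrable_phase.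
- exact: vintegrableZ.
move=> y; have T := cos_taylor_le (theta + dot xi y) (h * y i 0).
rewrite (_ : _ - _ - _ = f y * (cos (theta + dot xi y + h * y i 0) -
    cos (theta + dot xi y) + h * y i 0 * sin (theta + dot xi y))); last first.
  rewrite dotDl dotZl (dotC (e_ i)) dot_delta (addrAC theta) cosD_pihalf.
  rewrite (_ : theta + (h * _ + _) = theta + dot xi y + h * y i 0); last by ring.
  by ring.
rewrite normrM (le_trans (ler_wpM2l (normr_ge0 _) T))//.
rewrite !normrM (_ : (h * y i 0) ^+ 2 = h ^+ 2 * (`|y i 0| * `|y i 0|)); last first.
  by rewrite exprMn -expr2 real_normK ?num_real.
by rewrite le_eqVlt; apply/orP; left; apply/eqP; ring.
Qed.

End oscillatory.

Section oscillatory_schwartz.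
Variables (R : realType) (d : nat).
Local Notation V := 'cV[R]_d.
Implicit Types (f g F G : V -> R) (x y xi : V) (s : seq 'I_d).

Local Notation e_ i := (delta_mx i 0 : V).

Lemma derive_osc f theta i : testfn f ->
  partial [:: i] (osc f theta) = osc (fun y => y i 0 * f y) (theta + pi / 2).
Proof. by move=> tf; apply/funext => xi /=; have [_ ->] := is_derive_osc theta xi i tf. Qed.

Lemma partial_osc f theta s : testfn f ->
  exists g theta', testfn g /\ partial s (osc f theta) = osc g theta'.
Proof.
move=> tf; elim: s => [|i s [g [th [tg E]]]]; first by exists f, theta.
exists (fun y => y i 0 * g y), (th + pi / 2); split; first exact: testfn_coordM.
by rewrite -derive_osc// -E.
Qed.

Lemma smoothR_osc f theta : testfn f -> smoothR (osc f theta).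
Proof.
move=> tf s; have [g [th [tg ->]]] := partial_osc theta s tf; split.
  exact: continuous_osc.
by move=> i x; have [] := is_derive_osc th x i tg.
Qed.

(** The induction on the number of derivatives removes the innermost one, which
    only replaces f by y_i f; the bounds of the d possible choices are added. *)
Lemma seminorms_osc f N : testfn f ->
  exists B, forall theta, seminormsR_le N B (osc f theta).
Proof.
suff H n : forall f, testfn f -> exists B, 0 <= B /\ forall theta k s xi,
    (k <= N)%N -> (size s <= n)%N -> `|xi| ^+ k * `|partial s (osc f theta) xi| <= B.
  by move=> /(H N)[B [_ HB]]; exists B => theta k s kN sN xi; exact: HB.
elim: n => [|n IH] {}f tf.
  have [B [B0 HB]] := osc_decay tf N; exists B; split => // theta k s xi kN.
  rewrite leqn0 size_eq0 => /eqP -> /=; apply: le_trans (HB theta xi).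
  rewrite ler_wpM2r//; apply: (le_trans (y := (1 + `|xi|) ^+ k)).
    by rewrite lerXn2r ?nnegrE ?addr_ge0// lerDr.
  by rewrite ler_weXn2l// lerDl.
have [B0 [B00 HB0]] := IH f tf.
have /choice[B HB] i := IH _ (testfn_coordM i tf).
have S0 : 0 <= \sum_i B i by rewrite sumr_ge0// => i _; have [] := HB i.
exists (B0 + \sum_i B i); split; first by rewrite addr_ge0.
move=> theta k s xi kN; case: (lastP s) => [_|s' i].
  by rewrite (le_trans (HB0 theta k [::] xi kN _))// lerDl.
rewrite size_rcons ltnS -cats1 partial_cat derive_osc// => sn.
rewrite (le_trans ((HB i).2 _ _ _ _ kN sn))// (bigD1 i)//= addrCA lerDl addr_ge0//.
by rewrite sumr_ge0// => j _; have [] := HB j.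
Qed.

Lemma partialD F G s : smoothR F -> smoothR G ->
  partial s (fun x => F x + G x) = fun x => partial s F x + partial s G x.
Proof.
move=> sF sG; elim: s => [//|i s IH]; apply/funext => x.
have := is_deriveD (smoothR_is_derive s i x sF) (smoothR_is_derive s i x sG).
by rewrite /= IH => -[_ <-].
Qed.

Lemma smoothRD F G : smoothR F -> smoothR G -> smoothR (fun x => F x + G x).
Proof.
move=> sF sG s; rewrite partialD//; split.
  by apply: vcontinuousD; [exact: (sF s).1|exact: (sG s).1].
move=> i x; have := is_deriveD (smoothR_is_derive s i x sF) (smoothR_is_derive s i x sG).
by case.
Qed.

Lemma seminormsRD F G N A B : smoothR F -> smoothR G ->
  seminormsR_le N A F -> seminormsR_le N B G ->
  seminormsR_le N (A + B) (fun x => F x + G x).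
Proof.
move=> sF sG HF HG k s kN sN x; rewrite partialD//.
rewrite (le_trans (ler_wpM2l _ (ler_normD _ _)))// ?exprn_ge0//.
by rewrite mulrDr lerD ?HF ?HG.
Qed.

(** Decay of order N + 2 d leaves enough to dominate by [weight]. *)
Lemma osc_weight f N : testfn f -> exists B, 0 <= B /\
  forall theta xi, (1 + `|xi|) ^+ N * `|osc f theta xi| <= B * weight xi.
Proof.
move=> tf; have [B [B0 HB]] := osc_decay tf (N + 2 * d); exists B; split => // theta xi.
have P : 0 < (1 + `|xi|) ^+ (2 * d) by rewrite exprn_gt0// ltr_wpDr.
apply: (le_trans (y := B * (1 + `|xi|) ^- (2 * d))).
  by rewrite ler_pdivlMr// mulrAC -exprD HB.
rewrite ler_wpM2l// (le_trans _ (weight_lower xi))// exprM.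
have P1 : 0 < 1 + `|xi| by rewrite ltr_wpDr.
have Q : 0 < 1 + `|xi| ^+ 2 by rewrite ltr_wpDr// sqr_ge0.
rewrite lef_pV2 ?posrE ?exprn_gt0//.
apply: lerXn2r; rewrite ?nnegrE; [exact: ltW|exact/ltW/exprn_gt0|].
by rewrite sqrrD expr1n mul1r lerD2r lerDl mulrn_wge0.
Qed.

End oscillatory_schwartz.

(** * Fourier inversion *)

Section inversion.
Variables (R : realType) (d : nat).
Local Notation T := (measurableTypeR R).
Local Notation V := 'cV[R]_d.
Implicit Types (f g F G : V -> R) (x y z xi : V).

Definition abelV (a : R) xi := \prod_i abel a (xi i 0).

Lemma abelVE a xi : abelV a xi = expR (- (a * \sum_i `|xi i 0|)).
Proof. by rewrite mulr_sumr -sumrN expR_sum. Qed.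

Lemma abelV_ge0 a xi : 0 <= abelV a xi.
Proof. by rewrite abelVE expR_ge0. Qed.

Lemma abelV_le1 a xi : 0 <= a -> abelV a xi <= 1.
Proof.
by move=> a0; rewrite abelVE -expR0 ler_expR oppr_le0 mulr_ge0// sumr_ge0.
Qed.

Lemma vintegrable_abelV a : 0 < a -> vintegrable (abelV a).
Proof.
move=> a0; rewrite /vintegrable /abelV.
under eq_fun do under eq_bigr do rewrite tnth_colv.
by apply: integrable_tensor; exact: integrable_abel.
Qed.

Lemma rintegral_abelV a theta z : 0 < a ->
  rintegral (fun xi => abelV a xi * cos (theta + dot xi z)) =
  cos theta * \prod_i (2 * a / (a ^+ 2 + z i 0 ^+ 2)).
Proof.
move=> a0; rewrite /rintegral /Rintegral /abelV.
have E (t : d.-tuple T) : dot (colv t) z = \sum_i tnth t i * z i 0.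
  by rewrite dotE; apply: eq_bigr => i _; rewrite tnth_colv.
under eq_integral => t _.
  under eq_bigr do rewrite tnth_colv.
  rewrite E.
  over.
by rewrite (integral_tensor_cos (fun i => z i 0) theta (integrable_abel a0) (integral_abel_phase a0)).
Qed.

Lemma cauchy_product a z : 0 < a ->
  \prod_i (2 * a / (a ^+ 2 + z i 0 ^+ 2)) = (2 / a) ^+ d * weight (a^-1 *: z).
Proof.
move=> a0; rewrite -[X in (2 / a) ^+ X]card_ord -prodr_const -big_split /=.
apply: eq_bigr => i _; rewrite mxE; have A := lt0r_neq0 a0.
set u := a^-1 * z i 0.
have -> : z i 0 = a * u by rewrite /u mulrA divff// mul1r.
have D : 1 + u ^+ 2 != 0 by rewrite lt0r_neq0// ltr_wpDr ?sqr_ge0.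
have -> : a ^+ 2 + (a * u) ^+ 2 = a ^+ 2 * (1 + u ^+ 2) by ring.
by field; rewrite A D.
Qed.

Lemma cvg_abelV xi : abelV (n.+1%:R^-1) xi @[n --> \oo] --> (1 : R).
Proof.
under eq_fun do rewrite abelVE.
set S := \sum_i `|xi i 0|.
have : expR (- (n.+1%:R^-1 * S)) @[n --> \oo] --> expR (- (0 * S)).
  apply: (cvg_comp (fun n : nat => - (n.+1%:R^-1 * S)) expR (G := nbhs (- (0 * S))));
    last exact: continuous_expR.
  by apply: cvgN; apply: cvgMl; exact: cvg_harmonic.
by rewrite mul0r oppr0 expR0.
Qed.

Let H f theta x xi := osc f (theta - dot xi x) xi.

Let HE f theta x xi : testfn f -> H f theta x xi =
  cos (dot x xi) * osc f theta xi + sin (dot x xi) * osc f (theta - pi / 2) xi.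
Proof.
move=> /testfn_cont_compact cf; rewrite /H -!rintegralZ; [|exact: cont_compact_vintegrable_phase..].
rewrite -rintegralD; [|by apply: vintegrableZ; exact: cont_compact_vintegrable_phase..].
apply: eq_rintegral => y.
have -> : cos (theta - pi / 2 + dot xi y) = sin (theta + dot xi y).
  by rewrite addrAC cosB cos_pihalf sin_pihalf mulr0 mulr1 add0r.
by rewrite (addrAC theta) cosB (dotC x); ring.
Qed.

Let continuous_H f theta x : testfn f -> continuous (H f theta x).
Proof.
move=> tf; rewrite (_ : H f theta x = fun xi =>
  cos (dot x xi) * osc f theta xi + sin (dot x xi) * osc f (theta - pi / 2) xi); last first.
  by apply/funext => xi; rewrite HE.
apply: vcontinuousD; apply: vcontinuousM; try exact: continuous_osc.
  by apply: vcontinuous_comp; [exact: continuous_cos|exact: continuous_dotr].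
by apply: vcontinuous_comp; [exact: continuous_sin|exact: continuous_dotr].
Qed.

Lemma vmeasurable2_dot :
  vmeasurable2 (fun xi y : V => dot xi y).
Proof.
rewrite /vmeasurable2; under eq_fun do rewrite dotE.
apply: measurable_sum => i; apply: measurable_funM.
  exact: (measurableT_comp (@measurable_coord R d i) measurable_fst).
exact: (measurableT_comp (@measurable_coord R d i) measurable_snd).
Qed.

(** Fubini brings the frequency integral inside, where the Abel kernel makes it
    explicit; the substitution y = x + a z then frees the resulting Cauchy kernel
    from a. *)
Lemma rintegral_osc_abel f theta x a : testfn f -> 0 < a ->
  rintegral (fun xi => osc f (theta - dot xi x) xi * abelV a xi) =
  cos theta * 2 ^+ d * rintegral (fun z => f (x + a *: z) * weight z).
Proof.
move=> tf a0; have cf := testfn_cont_compact tf.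
pose K xi y := f y * cos (theta - dot xi x + dot xi y) * abelV a xi.
transitivity (rintegral (fun xi => rintegral (K xi))).
  apply: eq_rintegral => xi; rewrite mulrC -rintegralZ; last exact: cont_compact_vintegrable_phase.
  by apply: eq_rintegral => y; rewrite mulrC.
have mf : vmeasurable f by apply: vintegrable_measurable; exact: cont_compact_vintegrable.
have mK : vmeasurable2 K.
  apply: measurable_funM; last first.
    apply: (measurableT_comp (vintegrable_measurable (vintegrable_abelV a0)) measurable_fst).
  apply: measurable_funM.
    exact: (measurableT_comp mf measurable_snd).
  apply: (measurableT_comp (continuous_measurable_fun (@continuous_cos R))).
  apply: measurable_funD; last exact: vmeasurable2_dot.
  apply: measurable_funB => //.
  have mx : vmeasurable (fun xi => dot xi x).
    apply: measurable_continuous; under eq_fun do rewrite dotC; exact: continuous_dotr.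
  exact: (measurableT_comp mx measurable_fst).
rewrite (@rintegral_fubini _ _ K (abelV a) (fun y => `|f y|)) //; last 3 first.
- exact: vintegrable_abelV.
- by apply: vintegrable_norm; exact: cont_compact_vintegrable.
- move=> xi y; rewrite /K normrM (ger0_norm (abelV_ge0 _ _)) mulrC ler_wpM2l ?abelV_ge0//.
  by rewrite normrM ler_piMr// norm_cos_le1.
have E y : rintegral (fun xi => K xi y) =
    f y * (cos theta * ((2 / a) ^+ d * weight (a^-1 *: (y - x)))).
  rewrite -cauchy_product// -rintegral_abelV// -rintegralZ.
    apply: eq_rintegral => xi; rewrite /K dotBr.
    rewrite (_ : theta - dot xi x + dot xi y = theta + (dot xi y - dot xi x)); last by ring.
    by ring.
  apply: (@le_vintegrable _ _ _ (abelV a)); last exact: vintegrable_abelV.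
    have mc : vmeasurable (fun xi => cos (theta + dot xi (y - x))).
      apply: measurable_continuous.
      apply: vcontinuous_comp; first exact: continuous_cos.
      apply: vcontinuousD; first exact: vcontinuous_cst.
      under eq_fun do rewrite dotC; exact: continuous_dotr.
    by apply: measurable_funM => //; exact: (vintegrable_measurable (vintegrable_abelV a0)).
  by move=> xi; rewrite normrM (ger0_norm (abelV_ge0 _ _)) ler_piMr ?abelV_ge0// norm_cos_le1.
have Iw : vintegrable (fun z => f (x + a *: z) * weight z).
  have [C fC] := cont_compact_bounded cf.
  apply: (@le_vintegrable _ _ _ (fun z => C * weight z)).
  - apply: measurable_funM; first exact: vmeasurable_affine.
    exact: (vintegrable_measurable (@vintegrable_weight R d)).
  - by move=> z; rewrite normrM (ger0_norm (weight_ge0 _)) ler_wpM2r ?weight_ge0.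
  - by apply: vintegrableZ; exact: vintegrable_weight.
rewrite (eq_rintegral E) (rintegral_affine x a0); last first.
  apply: cont_compact_vintegrable.
  have cP : continuous (fun y => cos theta * ((2 / a) ^+ d * weight (a^-1 *: (y - x)))).
    apply: vcontinuousM; first exact: vcontinuous_cst.
    apply: vcontinuousM; first exact: vcontinuous_cst.
    apply: continuous_big => /=; first exact: mul_continuous.
    move=> i _; apply: (@vcontinuous_comp R d (fun t : R => (1 + t ^+ 2)^-1)
      (fun y : V => (a^-1 *: (y - x)) i 0)); first exact: continuous_oneDsqrV.
    rewrite (_ : (fun _ => _) = fun y : V => a^-1 * (y i 0 + - x i 0)).
      apply: vcontinuousM; first exact: vcontinuous_cst.
      by apply: vcontinuousD; [exact: continuous_coord|exact: vcontinuous_cst].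
    by apply/funext => y; rewrite !mxE.
  have := cont_compactM cP cf.
  by under eq_fun do rewrite mulrC.
(* The powers of a in the Jacobian and in the kernel cancel. *)
have Ez z : f (x + a *: z) * (cos theta * ((2 / a) ^+ d * weight (a^-1 *: (x + a *: z - x)))) =
    (cos theta * (2 / a) ^+ d) * (f (x + a *: z) * weight z).
  by rewrite (addrC x) addrK scalerA mulVf ?lt0r_neq0// scale1r; ring.
rewrite (eq_rintegral Ez) rintegralZ//.
have -> : (2 : R) ^+ d = a ^+ d * (2 / a) ^+ d.
  by rewrite -exprMn mulrCA divff ?mulr1// lt0r_neq0.
by ring.
Qed.

Lemma osc_phase_vmeasurable f theta x : testfn f ->
  vmeasurable (fun xi => osc f (theta - dot xi x) xi).
Proof. by move=> tf; apply: measurable_continuous; exact: continuous_H. Qed.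

Lemma osc_phase_vintegrable f theta x : testfn f ->
  vintegrable (fun xi => osc f (theta - dot xi x) xi).
Proof.
move=> tf; have [B [B0 HB]] := osc_weight 0 tf.
apply: (@vintegrable_le_weight _ _ _ B); first exact: osc_phase_vmeasurable.
by move=> xi; have := HB (theta - dot xi x) xi; rewrite expr0 mul1r.
Qed.

(** Both sides of [rintegral_osc_abel] have a limit as a tends to 0: on the left
    the Abel factor tends to 1, on the right f (x + a z) tends to f x. *)
Lemma fourier_inversion f theta x : testfn f ->
  rintegral (fun xi => osc f (theta - dot xi x) xi) = (2 * pi) ^+ d * cos theta * f x.
Proof.
move=> tf; have cf := testfn_cont_compact tf.
pose a n : R := n.+1%:R^-1.
have a0 n : 0 < a n by rewrite invr_gt0.
have l1 : rintegral (fun xi => osc f (theta - dot xi x) xi * abelV (a n) xi) @[n --> \oo] -->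
          rintegral (fun xi => osc f (theta - dot xi x) xi).
  apply: (rintegral_dominatedT (G := fun xi => `|osc f (theta - dot xi x) xi|)).
  - move=> n; apply: measurable_funM; first exact: osc_phase_vmeasurable.
    exact: (vintegrable_measurable (vintegrable_abelV (a0 n))).
  - exact: osc_phase_vmeasurable.
  - move=> xi.
    have := cvgM (cvg_cst (osc f (theta - dot xi x) xi)) (cvg_abelV xi).
    by rewrite mulr1; apply.
  - by apply: vintegrable_norm; exact: osc_phase_vintegrable.
  - move=> n xi; rewrite normrM (ger0_norm (abelV_ge0 _ _)) ler_piMr//.
    by apply: abelV_le1; exact: ltW.
have l2 : rintegral (fun z => f (x + a n *: z) * weight z) @[n --> \oo] -->
          rintegral (fun z => f x * @weight R d z).
  have [C fC] := cont_compact_bounded cf.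
  have mw := vintegrable_measurable (@vintegrable_weight R d).
  apply: (rintegral_dominatedT (G := fun z => C * weight z)).
  - move=> n; apply: measurable_funM => //; apply: vmeasurable_affine.
    by apply: vintegrable_measurable; exact: cont_compact_vintegrable.
  - exact: measurable_funM.
  - move=> z; apply: cvgM; last exact: cvg_cst.
    apply: (cvg_comp (fun n => x + a n *: z) f (G := nbhs x)); last exact: cf.1.
    have := cvgD (cvg_cst x) (cvgZr_tmp (a := z) (@cvg_harmonic R)).
    by rewrite scale0r addr0; apply.
  - by apply: vintegrableZ; exact: vintegrable_weight.
  - by move=> n z; rewrite normrM (ger0_norm (weight_ge0 _)) ler_wpM2r ?weight_ge0.
have l3 : rintegral (fun xi => osc f (theta - dot xi x) xi * abelV (a n) xi) @[n --> \oo] -->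
          cos theta * 2 ^+ d * rintegral (fun z => f x * @weight R d z).
  under eq_fun do rewrite rintegral_osc_abel//.
  by apply: cvgMr.
rewrite -(cvg_lim _ l1)// (cvg_lim _ l3)// rintegralZ; last exact: vintegrable_weight.
by rewrite rintegral_weight exprMn; ring.
Qed.

(** The product of the two cosines is split into a sum, and each half is an
    inversion integral, at - x and at x. *)
Lemma fourier_inversion_cos f theta psi x : testfn f ->
  rintegral (fun xi => osc f theta xi * cos (psi + dot xi x)) =
  (2 * pi) ^+ d / 2 * (cos (theta + psi) * f (- x) + cos (theta - psi) * f x).
Proof.
move=> tf; have cf := testfn_cont_compact tf.
have E xi : osc f theta xi * cos (psi + dot xi x) =
    2^-1 * (osc f (theta + psi - dot xi (- x)) xi + osc f (theta - psi - dot xi x) xi).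
  rewrite /osc -rintegralD; [|exact: cont_compact_vintegrable_phase..].
  have I1 th : vintegrable (fun y => f y * cos (th + dot xi y)).
    exact: cont_compact_vintegrable_phase.
  rewrite mulrC -rintegralZ// -rintegralZ; last exact: vintegrableD.
  apply: eq_rintegral => y; rewrite dotNr opprK.
  rewrite (_ : theta + psi + _ + _ = (theta + dot xi y) + (psi + dot xi x)); last by ring.
  rewrite (_ : theta - psi - _ + _ = (theta + dot xi y) - (psi + dot xi x)); last by ring.
  by rewrite (cosD (theta + dot xi y)) cosB; field.
rewrite (eq_rintegral E) rintegralZ; last by apply: vintegrableD; exact: osc_phase_vintegrable.
rewrite rintegralD; [|exact: osc_phase_vintegrable..].
by rewrite !fourier_inversion//; field.
Qed.

End inversion.

Section inverse_fourier.
Local Open Scope complex_scope.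
Variables (R : realType) (d : nat).
Local Notation V := 'cV[R]_d.
Implicit Types (x k xi : V).

Definition osc_pair (f1 f2 : V -> R) th1 th2 xi := osc f1 th1 xi + osc f2 th2 xi.

Section osc_pair.
Variables (f1 f2 : V -> R).
Hypotheses (tf1 : testfn f1) (tf2 : testfn f2).

Lemma smoothR_osc_pair th1 th2 : smoothR (osc_pair f1 f2 th1 th2).
Proof. by apply: smoothRD; exact: smoothR_osc. Qed.

Lemma seminorms_osc_pair N th1 th2 : exists B, seminormsR_le N B (osc_pair f1 f2 th1 th2).
Proof.
have [A HA] := seminorms_osc N tf1; have [B HB] := seminorms_osc N tf2.
by exists (A + B); apply: seminormsRD => //; exact: smoothR_osc.
Qed.

Lemma osc_pair_weight N th1 th2 : exists B, forall xi,
  (1 + `|xi|) ^+ N * `|osc_pair f1 f2 th1 th2 xi| <= B * weight xi.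
Proof.
have [A [_ HA]] := osc_weight N tf1; have [B [_ HB]] := osc_weight N tf2.
exists (A + B) => xi; rewrite /osc_pair.
rewrite (le_trans (ler_wpM2l _ (ler_normD _ _)))// ?exprn_ge0// ?addr_ge0//.
by rewrite mulrDr mulrDl lerD ?HA ?HB.
Qed.

Lemma continuous_osc_pair th1 th2 : continuous (osc_pair f1 f2 th1 th2).
Proof. by apply: vcontinuousD; exact: continuous_osc. Qed.

Let vintegrable_osc_cos f th psi x : testfn f ->
  vintegrable (fun xi => osc f th xi * cos (psi + dot xi x)).
Proof.
move=> tf; have [B [_ HB]] := osc_weight 0 tf.
apply: (@vintegrable_le_weight _ _ _ B).
  apply: measurable_continuous; apply: vcontinuousM; first exact: continuous_osc.
  apply: vcontinuous_comp; first exact: continuous_cos.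
  apply: vcontinuousD; first exact: vcontinuous_cst.
  by under eq_fun do rewrite dotC; exact: continuous_dotr.
move=> xi; have := HB th xi; rewrite expr0 mul1r; apply: le_trans.
by rewrite normrM ler_piMr// norm_cos_le1.
Qed.

Lemma vintegrable_osc_pair_cos th1 th2 psi x :
  vintegrable (fun xi => osc_pair f1 f2 th1 th2 xi * cos (psi + dot xi x)).
Proof.
by under eq_fun do rewrite mulrDl; apply: vintegrableD; exact: vintegrable_osc_cos.
Qed.

Lemma rintegral_osc_pair th1 th2 psi x :
  rintegral (fun xi => osc_pair f1 f2 th1 th2 xi * cos (psi + dot xi x)) =
  (2 * pi) ^+ d / 2 * ((cos (th1 + psi) * f1 (- x) + cos (th1 - psi) * f1 x) +
                       (cos (th2 + psi) * f2 (- x) + cos (th2 - psi) * f2 x)).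
Proof.
rewrite [LHS](_ : _ = rintegral (fun xi => osc f1 th1 xi * cos (psi + dot xi x) +
    osc f2 th2 xi * cos (psi + dot xi x))); last first.
  by apply: eq_rintegral => xi; rewrite mulrDl.
rewrite rintegralD; [|exact: vintegrable_osc_cos..].
by rewrite !fourier_inversion_cos// -mulrDr.
Qed.

End osc_pair.

(** With c = (2 pi)^(- d), g1 + i g2 is the inverse Fourier transform of f; a cosine
    of frequency k only sees the values f k and f (- k). *)
Lemma inverse_fourier (f : V -> R[i]) : smooth f -> compact (tsupp f) ->
  exists g1 g2 : V -> R,
  [/\ schwartz (fun xi => g1 xi +i* g2 xi),
      fourier (fun xi => g1 xi +i* g2 xi) = f,
      (forall g, g = g1 \/ g = g2 -> forall psi k, f k = 0 -> f (- k) = 0 ->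
         rintegral (fun xi => g xi * cos (psi + dot xi k)) = 0) &
      (forall g, g = g1 \/ g = g2 -> continuous g /\ forall N, exists B, forall xi,
         (1 + `|xi|) ^+ N * `|g xi| <= B * weight xi)].
Proof.
move=> [s1 s2] /compact_norm_le[L fL].
have f0 x : L < `|x| -> f x = 0.
  apply: contraTeq => fx0; rewrite -leNgt; apply: fL; exact: subset_closure.
pose c : R := (2 * pi) ^- d.
pose f1 x := c * complex.Re (f x); pose f2 x := c * complex.Im (f x).
have tf1 : testfn f1 by apply: testfnZ; split => //; exists L => x /f0 ->.
have tf2 : testfn f2 by apply: testfnZ; split => //; exists L => x /f0 ->.
have pd0 : (2 * pi) ^+ d != 0 :> R by rewrite expf_neq0// mulf_neq0// lt0r_neq0// pi_gt0.
have f1E x : complex.Re (f x) = (2 * pi) ^+ d * f1 x by rewrite /f1 /c mulVKf.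
have f2E x : complex.Im (f x) = (2 * pi) ^+ d * f2 x by rewrite /f2 /c mulVKf.
pose g1 := osc_pair f1 f2 0 (pi / 2); pose g2 := osc_pair f1 f2 (- (pi / 2)) 0.
have I1 psi x : vintegrable (fun xi => g1 xi * cos (psi + dot xi x)).
  exact: vintegrable_osc_pair_cos.
have I2 psi x : vintegrable (fun xi => g2 xi * cos (psi + dot xi x)).
  exact: vintegrable_osc_pair_cos.
have cosE (a : R) : cos a = cos (0 + a) by rewrite add0r.
have sinE (a : R) : sin a = cos (- (pi / 2) + a).
  by rewrite addrC cosB cos_pihalf sin_pihalf mulr0 mulr1 add0r.
have cNpi2 : cos (- (pi / 2) - pi / 2) = - 1 :> R by rewrite -opprD -splitr cosN cospi.
exists g1, g2; split.
- split; first by split; exact: smoothR_osc_pair.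
  move=> N; have [A HA] := seminorms_osc_pair tf1 tf2 N 0 (pi / 2).
  have [B HB] := seminorms_osc_pair tf1 tf2 N (- (pi / 2)) 0.
  exists (Num.max A B); split => k s kN sN x.
    by rewrite (le_trans (HA k s kN sN x))// le_max lexx.
  by rewrite (le_trans (HB k s kN sN x))// le_max lexx orbT.
- apply/funext => x; rewrite /fourier /cintegral.
  have -> : rintegral (fun xi => complex.Re ((g1 xi +i* g2 xi) *
      (cos (dot x xi) -i* sin (dot x xi)))) = complex.Re (f x).
    rewrite [LHS](_ : _ = rintegral (fun xi => g1 xi * cos (0 + dot xi x) +
       g2 xi * cos (- (pi / 2) + dot xi x))); last first.
      by apply: eq_rintegral => xi /=; rewrite -cosE -sinE (dotC x) mulrN opprK.
    rewrite rintegralD// !rintegral_osc_pair// f1E.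
    rewrite !(addr0, add0r, sub0r, subr0, opprK, subrr, addNr) cNpi2 !(cosN, cos_pihalf, cos0).
    by field.
  have -> : rintegral (fun xi => complex.Im ((g1 xi +i* g2 xi) *
      (cos (dot x xi) -i* sin (dot x xi)))) = complex.Im (f x).
    rewrite [LHS](_ : _ = rintegral (fun xi => g2 xi * cos (0 + dot xi x) -
       g1 xi * cos (- (pi / 2) + dot xi x))); last first.
      by apply: eq_rintegral => xi /=; rewrite -cosE -sinE (dotC x) mulrN addrC.
    rewrite rintegralB// !rintegral_osc_pair// f2E.
    rewrite !(addr0, add0r, sub0r, subr0, opprK, subrr, addNr) -splitr cospi !(cosN, cos_pihalf, cos0).
    by field.
  by case: (f x).
- by move=> g [|] -> psi k fk fNk; rewrite rintegral_osc_pair// /f1 /f2 fk fNk;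
    rewrite !mulr0 !addr0 mulr0.
- by move=> g [|] ->; split => [|N];
    [exact: continuous_osc_pair|exact: osc_pair_weight|
     exact: continuous_osc_pair|exact: osc_pair_weight].
Qed.

End inverse_fourier.

(** * Trigonometric polynomials *)

Section trigonometric_polynomials.
Variables (R : realType) (d : nat).
Local Notation V := 'cV[R]_d.
Implicit Types (p g : V -> R) (k x xi eta : V) (rho : R).

(** A triple (a, theta, k) stands for the term a cos (theta + k.xi). Products and
    translates of such terms are again of this form, up to sums. *)
Definition trig_sum (s : seq (R * R * V)) xi : R :=
  \sum_(t <- s) t.1.1 * cos (t.1.2 + dot t.2 xi).

Definition trigpoly rho p := exists s,
  all (fun t : R * R * V => `|t.2| <= rho) s /\ p = trig_sum s.

Lemma trigpoly_le rho rho' p : rho <= rho' -> trigpoly rho p -> trigpoly rho' p.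
Proof.
move=> le_rho [s [/allP sP ->]]; exists s; split => //.
by apply/allP => t /sP h; exact: le_trans le_rho.
Qed.

Lemma trigpoly_cos rho a theta k : `|k| <= rho ->
  trigpoly rho (fun xi => a * cos (theta + dot k xi)).
Proof.
move=> kr; exists [:: (a, theta, k)]; split; first by rewrite /= andbT.
by apply/funext => xi; rewrite /trig_sum big_seq1.
Qed.

Lemma trigpoly_cst rho a : 0 <= rho -> trigpoly rho (fun=> a).
Proof.
move=> r0; rewrite (_ : (fun=> a) = fun xi => a * cos (0 + dot (0 : V) xi)).
  by apply: trigpoly_cos; rewrite normr0.
by apply/funext => xi; rewrite dotC dot0r addr0 cos0 mulr1.
Qed.

Lemma trigpolyD rho p p' : trigpoly rho p -> trigpoly rho p' ->
  trigpoly rho (fun xi => p xi + p' xi).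
Proof.
move=> [s [sP ->]] [s' [sP' ->]]; exists (s ++ s'); split; first by rewrite all_cat sP.
by apply/funext => xi; rewrite /trig_sum big_cat.
Qed.

Lemma trigpoly_sum (I : Type) (r : seq I) (P : pred I) (F : I -> V -> R) rho : 0 <= rho ->
  (forall i, trigpoly rho (F i)) -> trigpoly rho (fun xi => \sum_(i <- r | P i) F i xi).
Proof.
move=> r0 tF; elim: r => [|i r IH].
  rewrite (_ : (fun _ => _) = fun=> 0); first exact: trigpoly_cst.
  by apply/funext => xi; rewrite big_nil.
case Pi : (P i); last first.
  rewrite (_ : (fun _ => _) = fun xi => \sum_(i <- r | P i) F i xi)//.
  by apply/funext => xi; rewrite big_cons Pi.
rewrite (_ : (fun _ => _) = fun xi => F i xi + \sum_(i <- r | P i) F i xi).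
  exact: trigpolyD.
by apply/funext => xi; rewrite big_cons Pi.
Qed.

(** Product-to-sum formula, term by term. *)
Lemma trigpolyM rho rho' p p' : trigpoly rho p -> trigpoly rho' p' ->
  trigpoly (rho + rho') (fun xi => p xi * p' xi).
Proof.
move=> [s [/allP sP ->]] [s' [/allP sP' ->]].
exists ([seq (u.1.1 * t.1.1 / 2, u.1.2 + t.1.2, u.2 + t.2) | u <- s, t <- s'] ++
        [seq (u.1.1 * t.1.1 / 2, u.1.2 - t.1.2, u.2 - t.2) | u <- s, t <- s']).
split.
  rewrite all_cat; apply/andP; split; apply/allP => _ /allpairsP[[u t] [us ts ->]] /=.
    by rewrite (le_trans (ler_normD _ _))// lerD ?sP ?sP'.
  by rewrite (le_trans (ler_normB _ _))// lerD ?sP ?sP'.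
apply/funext => xi; rewrite /trig_sum big_cat !big_allpairs_dep /= -big_split /=.
rewrite big_distrl /=; apply: eq_bigr => u _.
rewrite big_distrr /= -big_split /=; apply: eq_bigr => t _ /=.
rewrite !(dotC _ xi) dotBr dotDr.
rewrite (_ : u.1.2 + t.1.2 + _ = (u.1.2 + dot xi u.2) + (t.1.2 + dot xi t.2)); last by ring.
rewrite (_ : u.1.2 - t.1.2 + _ = (u.1.2 + dot xi u.2) - (t.1.2 + dot xi t.2)); last by ring.
by rewrite (cosD (u.1.2 + _)) cosB; field.
Qed.

Lemma trigpolyZ rho a p : trigpoly rho p -> trigpoly rho (fun xi => a * p xi).
Proof.
move=> tp; have [s [sP _]] := tp.
by rewrite -[rho]add0r; apply: trigpolyM => //; exact: trigpoly_cst.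
Qed.

Lemma trigpoly_shift rho p x : trigpoly rho p -> trigpoly rho (fun xi => p (xi + x)).
Proof.
move=> [s [sP ->]]; exists [seq (t.1.1, t.1.2 + dot t.2 x, t.2) | t <- s]; split.
  by rewrite all_map; apply: sub_all sP.
apply/funext => xi; rewrite /trig_sum big_map; apply: eq_bigr => t _ /=.
by rewrite dotDr (addrC (dot _ xi)) addrA.
Qed.

Lemma trigpoly_comp rho rho' (M : 'M[R]_d) p :
  (forall k, `|k| <= rho -> `|M^T *m k| <= rho') ->
  trigpoly rho p -> trigpoly rho' (fun xi => p (M *m xi)).
Proof.
move=> Mk [s [/allP sP ->]]; exists [seq (t.1, M^T *m t.2) | t <- s]; split.
  by apply/allP => _ /mapP[t ts ->]; apply: Mk; exact: sP.
apply/funext => xi; rewrite /trig_sum big_map; apply: eq_bigr => t _ /=.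
by rewrite /dot trmx_mul trmxK mulmxA.
Qed.

Lemma trigpoly_prod (I : Type) (r : seq I) (F : I -> V -> R) (rho : I -> R) :
  (forall i, trigpoly (rho i) (F i)) ->
  trigpoly (\sum_(i <- r) rho i) (fun xi => \prod_(i <- r) F i xi).
Proof.
move=> tF; elim: r => [|i r IH].
  rewrite big_nil (_ : (fun _ => _) = fun=> 1); first exact: trigpoly_cst.
  by apply/funext => xi; rewrite big_nil.
rewrite big_cons (_ : (fun _ => _) = fun xi => F i xi * \prod_(i <- r) F i xi).
  exact: trigpolyM.
by apply/funext => xi; rewrite big_cons.
Qed.

Lemma trigpoly_bounded rho p : trigpoly rho p -> exists M, 1 <= M /\ forall xi, `|p xi| <= M.
Proof.
move=> [s [_ ->]]; exists (1 + \sum_(t <- s) `|t.1.1|); split.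
  by rewrite lerDl sumr_ge0.
move=> xi; rewrite (le_trans (ler_norm_sum _ _ _))// ler_wpDl//.
by apply: ler_sum => t _; rewrite normrM ler_piMr// norm_cos_le1.
Qed.

Lemma trigpoly_lipschitz rho p : trigpoly rho p -> exists L, 0 <= L /\
  forall xi eta, `|p xi - p eta| <= L * `|xi - eta|.
Proof.
move=> [s [_ ->]]; exists (\sum_(t <- s) `|t.1.1| * (d%:R * `|t.2|)); split.
  by rewrite sumr_ge0// => t _; rewrite !mulr_ge0.
move=> xi eta; rewrite /trig_sum -sumrB (le_trans (ler_norm_sum _ _ _))// mulr_suml.
apply: ler_sum => t _; rewrite -mulrBr normrM -mulrA ler_wpM2l//.
rewrite (le_trans (norm_cosB_le _ _))// opprD addrACA subrr add0r -dotBr.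
exact: dot_le.
Qed.

Lemma continuous_trigpoly rho p : trigpoly rho p -> continuous p.
Proof.
move=> [s [_ ->]]; apply: continuous_seq_sum => t.
by apply: vcontinuousM; [exact: vcontinuous_cst|exact: continuous_phase].
Qed.

Lemma rintegral_trigpoly0 rho p g : trigpoly rho p ->
  (forall psi k, `|k| <= rho -> rintegral (fun xi => g xi * cos (psi + dot k xi)) = 0) ->
  continuous g -> (exists C, forall xi, `|g xi| <= C * weight xi) ->
  rintegral (fun xi => p xi * g xi) = 0.
Proof.
move=> [s [/allP sP ->]] g0 cg [C gC].
have I a psi k : vintegrable (fun xi => a * (g xi * cos (psi + dot k xi))).
  apply/vintegrableZ/(@vintegrable_le_weight _ _ _ C).
    apply: measurable_continuous; apply: vcontinuousM => //; exact: continuous_phase.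
  move=> xi; apply: le_trans (gC xi).
  by rewrite normrM ler_piMr// norm_cos_le1.
transitivity (rintegral (fun xi => \sum_(t <- s) t.1.1 * (g xi * cos (t.1.2 + dot t.2 xi)))).
  apply: eq_rintegral => xi; rewrite /trig_sum mulr_suml; apply: eq_bigr => t _; ring.
rewrite rintegral_sum// big_seq big1// => t ts.
have I1 := I 1 t.1.2 t.2.
under eq_fun do rewrite -[X in _ * X]mul1r.
by rewrite rintegralZ//; under eq_rintegral do rewrite mul1r; rewrite g0 ?mulr0// sP.
Qed.

End trigonometric_polynomials.

(** * The dilation *)

Section dilation.
Variables (R : realType) (d : nat).
Hypothesis d_gt0 : (0 < d)%N.
Local Notation V := 'cV[R]_d.

Lemma norm_mulmx (M : 'M[R]_d) (x : V) : `|M *m x| <= d%:R * `|M| * `|x|.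
Proof.
apply: norm_le_coord => [|i]; first by rewrite !mulr_ge0.
rewrite mxE (le_trans (ler_norm_sum _ _ _))//.
apply: (le_trans (y := \sum_(j < d) `|M| * `|x|)).
  apply: ler_sum => j _; rewrite normrM ler_pM ?coord_le_norm//.
  by rewrite [leRHS]mx_normrE; apply: (le_bigmax _ _ (i, j)).
by rewrite sumr_const card_ord -[leLHS]mulr_natl mulrA.
Qed.

Lemma sqr_norm2_bounds (x : V) : `|x| ^+ 2 <= \sum_i x i 0 ^+ 2 <= d%:R * `|x| ^+ 2.
Proof.
have c i : x i 0 ^+ 2 <= `|x| ^+ 2.
  by rewrite -[leLHS]real_normK ?num_real// lerXn2r ?nnegrE// coord_le_norm.
apply/andP; split.
  have [->|x0] := eqVneq `|x| 0; first by rewrite expr0n sumr_ge0// => i _; exact: sqr_ge0.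
  have [|i ->] := @norm_coord_ex _ _ x; first by rewrite lt_neqAle eq_sym x0 normr_ge0.
  rewrite real_normK ?num_real// (bigD1 i)//= lerDl sumr_ge0// => j _; exact: sqr_ge0.
rewrite (le_trans (ler_sum _ (fun i _ => c i)))// sumr_const card_ord.
by rewrite -[leLHS]mulr_natl.
Qed.

Variable A : 'M[int]_d.
Hypothesis hA : real_isotropic_dilation R A.

Let prod_gt1 (F : numDomainType) (r : seq F) : all (fun z => 1 < `|z|) r -> r != [::] ->
  1 < \prod_(z <- r) `|z|.
Proof.
elim: r => // z r IH /= /andP[z1 r1] _; rewrite big_cons.
case: r => [|y r] in IH r1 *; first by rewrite big_nil mulr1.
by rewrite mulr_egt1// IH.
Qed.

(** Up to sign, det A is the product of the eigenvalues. *)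
Lemma dil_q_gt1 : 1 < dil_q R A.
Proof.
have [h1 _ _] := hA; pose AC : 'M[R[i]]_d := map_mx intr A.
have [r E] := closed_field_poly_normal (char_poly AC).
rewrite (monicP (char_poly_monic _)) scale1r in E.
have sr : size r = d.
  by apply: succn_inj; rewrite -(size_char_poly AC) E size_prod_XsubC.
have rE : all (fun z => 1 < `|z|) r.
  apply/allP => z zr; apply: h1; rewrite eigenvalue_root_char E root_prod_XsubC//.
have r0 : r != [::] by rewrite -size_eq0 sr -lt0n.
have := prod_gt1 rE r0.
have -> : \prod_(z <- r) `|z| = `|\det AC|.
  have := congr1 (fun p => `|p.[0]|) E.
  rewrite /= horner_coef0 char_poly_det normrM normrX normrN1 expr1n mul1r => ->.
  rewrite horner_prod normr_prod; apply: eq_bigr => z _.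
  by rewrite hornerXsubC sub0r normrN.
rewrite det_map_mx -intr_norm -[1]/(1%:~R) ltr_int => q1.
by rewrite /dil_q -intr_norm -[1]/(1%:~R) ltr_int.
Qed.

Let q0 : 0 < dil_q R A. Proof. exact: lt_trans ltr01 dil_q_gt1. Qed.

Definition dil_r : R := dil_q R A `^ (- d%:R^-1).

Lemma dil_r_gt0 : 0 < dil_r. Proof. exact: powR_gt0. Qed.

Lemma dil_r_lt1 : dil_r < 1.
Proof.
rewrite /dil_r powRN invf_lt1 ?powR_gt0//.
have : 1 `^ d%:R^-1 < dil_q R A `^ d%:R^-1.
  apply: gt0_ltr_powR; rewrite ?invr_gt0 ?ltr0n ?nnegrE//; first exact: ltW.
  exact: dil_q_gt1.
by rewrite powR1.
Qed.

Lemma dil_q_powR : dil_q R A `^ (2 / d%:R) * dil_r ^+ 2 = 1.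
Proof.
rewrite -powR_mulrn ?ltW ?dil_r_gt0// -powRrM -powRD; last first.
  by apply/implyP => _; exact: lt0r_neq0.
by rewrite mulNr mulrC addrC addNr powRr0.
Qed.

Let AR : 'M[R]_d := map_mx intr A.

Lemma dil_unit : AR^T \in unitmx.
Proof.
rewrite unitmx_tr unitmxE det_map_mx unitfE -normr_gt0; exact: q0.
Qed.

Lemma mulmx_invtr (x : V) : AR^T *m (invtr R A *m x) = x.
Proof. by rewrite mulmxA mulmxV ?mul1mx// dil_unit. Qed.

Variable Q : 'M[R]_d.
Hypothesis hQ : elliptic_factor A Q.

Let Qsym : Q^T = Q. Proof. by case: hQ => -[]. Qed.

Lemma posdef_unit : Q \in unitmx.
Proof.
rewrite -row_free_unit -kermx_eq0; apply/rowV0P => v /sub_kermxP vQ.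
apply/eqP; apply: contraT => v0; have [[_ /(_ v^T)]] := hQ.
by rewrite trmxK vQ mul0mx mxE ltxx trmx_eq0 v0 => /(_ isT).
Qed.

Lemma quadPE (x : V) : quadP Q x = \sum_i (Q *m x) i 0 ^+ 2.
Proof.
rewrite /quadP mulmxA -mulmxA -{1}Qsym -trmx_mul mxE.
by apply: eq_bigr => i _; rewrite mxE.
Qed.

Lemma quadP_dot (x : V) : quadP Q x = dot (Q *m x) (Q *m x).
Proof. by rewrite /quadP /dot trmx_mul Qsym !mulmxA. Qed.

(** In the coordinates Q x the matrix A^{-T} is r times an orthogonal one. *)
Lemma quadP_invtr (x : V) : quadP Q (invtr R A *m x) = dil_r ^+ 2 * quadP Q x.
Proof.
have [_ [U oU BE]] := hQ.
have QB : Q *m (invtr R A *m x) = dil_r *: (U *m (Q *m x)).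
  by rewrite BE -/dil_r -scalemxAl -scalemxAr -!mulmxA (mulKVmx posdef_unit).
rewrite !quadP_dot QB dotZl dotZr mulrA -expr2; congr (_ * _).
by rewrite /dot trmx_mul -mulmxA (mulmxA U^T) oU mul1mx.
Qed.

Lemma quadP_lower : exists c, 0 < c /\ forall x, c * `|x| ^+ 2 <= quadP Q x.
Proof.
pose a := 1 + d%:R * `|invmx Q|.
have a0 : 0 < a by rewrite ltr_pwDl// mulr_ge0.
exists (a ^- 2); split; first by rewrite invr_gt0 exprn_gt0.
move=> x; rewrite quadPE ler_pdivrMl ?exprn_gt0//.
have [/andP[h _]] := sqr_norm2_bounds (Q *m x).
apply: (le_trans (y := a ^+ 2 * `|Q *m x| ^+ 2)).
  rewrite -exprMn lerXn2r ?nnegrE ?mulr_ge0 ?(ltW a0)//.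
  rewrite -{1}[x](mulKmx posdef_unit) (le_trans (norm_mulmx _ _))//.
  by rewrite ler_wpM2r// lerDr.
by rewrite ler_wpM2l// exprn_ge0// ltW.
Qed.

Lemma quadP_upper : exists c, 0 < c /\ forall x, quadP Q x <= c * `|x| ^+ 2.
Proof.
exists (1 + d%:R * (d%:R * `|Q|) ^+ 2); split.
  by rewrite ltr_pwDl// mulr_ge0// sqr_ge0.
move=> x; rewrite quadPE; have [/andP[_ h]] := sqr_norm2_bounds (Q *m x).
rewrite (le_trans h)// mulrDl mul1r ler_wpDl ?sqr_ge0// -mulrA ler_wpM2l//.
by rewrite -exprMn lerXn2r ?nnegrE ?mulr_ge0// norm_mulmx.
Qed.

Definition invtr_pow (j : nat) : 'M[R]_d := iter j (mulmx (invtr R A)) 1%:M.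

Lemma iter_invtr j (x : V) : iter j (mulmx (invtr R A)) x = invtr_pow j *m x.
Proof. by elim: j => [|j IH] /=; rewrite ?mul1mx// IH mulmxA. Qed.

Lemma quadP_pow j (x : V) : quadP Q (invtr_pow j *m x) = dil_r ^+ (2 * j) * quadP Q x.
Proof.
elim: j => [|j IH]; first by rewrite muln0 expr0 mul1r mul1mx.
by rewrite /= -mulmxA quadP_invtr IH mulrA -exprD mulnS.
Qed.

(** [quadP] is comparable to the square of the norm, and each application of
    A^{-T} multiplies it by r^2. *)
Lemma norm_invtr_pow : exists C, 0 <= C /\ forall j (x : V),
  `|invtr_pow j *m x| <= C * dil_r ^+ j * `|x|.
Proof.
have [c [c0 lo]] := quadP_lower; have [c' [c'0 up]] := quadP_upper.
exists (Num.sqrt (c' / c)); split; first exact: sqrtr_ge0.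
move=> j x; have r0 := ltW dil_r_gt0.
rewrite -(@ler_pXn2r _ 2)// ?nnegrE ?mulr_ge0 ?sqrtr_ge0 ?exprn_ge0//.
rewrite !exprMn sqr_sqrtr; last by apply: divr_ge0; exact: ltW.
rewrite -exprM mulnC.
rewrite -(ler_pM2l c0) (le_trans (lo _))// quadP_pow.
rewrite (_ : c * _ = dil_r ^+ (2 * j) * (c' * `|x| ^+ 2)).
  by rewrite ler_wpM2l ?exprn_ge0.
by field; exact: lt0r_neq0.
Qed.

Lemma norm_invtr_pow_tr : exists C, 0 <= C /\ forall j (k : V),
  `|(invtr_pow j)^T *m k| <= C * dil_r ^+ j * `|k|.
Proof.
have [C [C0 HC]] := norm_invtr_pow; have r0 := ltW dil_r_gt0.
exists (d%:R * C); split; first by rewrite mulr_ge0.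
move=> j k; apply: norm_le_coord => [|i]; first by rewrite !mulr_ge0// exprn_ge0.
have -> : ((invtr_pow j)^T *m k) i 0 = dot k (invtr_pow j *m delta_mx i 0).
  rewrite -dot_delta /dot trmx_mul trmxK mulmxA //.
rewrite (le_trans (dot_le _ _))// -!mulrA ler_wpM2l// mulrC mulrA ler_wpM2r//.
rewrite (le_trans (HC _ _))// ler_piMr ?mulr_ge0 ?exprn_ge0//.
exact: norm_delta_le1.
Qed.

End dilation.

(** * Infinite products of a mask *)

Section infinite_product.
Variable R : realType.

Lemma sum_geometricS (r : R) n : (\sum_(j < n) r ^+ j.+1) * (1 - r) = r - r ^+ n.+1.
Proof.
elim: n => [|n IH]; first by rewrite big_ord0 mul0r expr1 subrr.
by rewrite big_ord_recr /= mulrDl IH !exprS; ring.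
Qed.

(** Choose N with M r^N <= 1. For t > 1 the first factor is at most M, and the
    others form the same product at r t, so the bound E M max(1, t)^N propagates.
    For t <= 1 the product is at most the exponential of a geometric series. *)
Lemma prod_min_bound (M K r : R) : 1 <= M -> 0 <= K -> 0 < r -> r < 1 ->
  exists E N, 0 <= E /\ forall t n, 0 <= t ->
    \prod_(j < n) Num.min M (1 + K * r ^+ j.+1 * t) <= E * (1 + t) ^+ N.
Proof.
move=> M1 K0 r0 r1; have M0 : 0 < M by exact: lt_le_trans M1.
have [N MN] : exists N, M * r ^+ N <= 1.
  have : (fun n => r ^+ n) @ \oo --> (0 : R).
    by apply: cvg_expr; rewrite ger0_norm// ltW.
  move=> /cvgrPdist_lt/(_ M^-1); rewrite invr_gt0 => /(_ M0)[N _ /(_ N (leqnn N))] /=.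
  rewrite sub0r normrN ger0_norm ?exprn_ge0 ?(ltW r0)// => h; exists N.
  by rewrite -ler_pdivlMl// mulr1 ltW.
pose D n t := \prod_(j < n) Num.min M (1 + K * r ^+ j.+1 * t).
have D0 n t : 0 <= t -> 0 <= D n t.
  move=> t0; apply: prodr_ge0 => j _; rewrite le_min (ltW M0)/= addr_ge0//.
  by rewrite !mulr_ge0// exprn_ge0// ltW.
have DS n t : D n.+1 t = Num.min M (1 + K * r * t) * D n (r * t).
  rewrite /D big_ord_recl expr1; congr (_ * _); apply: eq_bigr => j _.
  by rewrite /= /bump add1n (exprSr _ j.+1) !mulrA.
pose E := expR (K / (1 - r)).
have r1' : 0 < 1 - r by rewrite subr_gt0.
have E1 : 1 <= E by rewrite -expR0 ler_expR divr_ge0// ltW.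
have small n t : 0 <= t -> t <= 1 -> D n t <= E.
  move=> t0 t1; apply: (le_trans (y := \prod_(j < n) expR (K * r ^+ j.+1))).
    apply: ler_prod => j _; apply/andP; split.
      rewrite le_min (ltW M0)/= addr_ge0//.
      by rewrite !mulr_ge0// exprn_ge0// ltW.
    rewrite ge_min; apply/orP; right; apply: le_trans (expR_ge1Dx _).
    by rewrite lerD2l ler_piMr// mulr_ge0// exprn_ge0// ltW.
  rewrite -expR_sum ler_expR -mulr_sumr ler_wpM2l//.
  rewrite -div1r ler_pdivlMr// sum_geometricS.
  by rewrite lerBlDr (le_trans (ltW r1))// lerDl exprn_ge0// ltW.
exists (E * M), N; split; first by rewrite mulr_ge0 ?(ltW M0)// (le_trans ler01).
have E0 : 0 <= E by exact: le_trans ler01 E1.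
move=> t n t0; rewrite -/(D n t).
suff H : D n t <= E * M * Num.max 1 t ^+ N.
  rewrite (le_trans H)// ler_wpM2l ?mulr_ge0 ?(ltW M0)//.
  apply: lerXn2r; rewrite ?nnegrE ?le_max ?ler01 ?addr_ge0//.
  by rewrite ge_max lerDl t0 lerDr ler01.
(* [E * M] rather than [E], to leave room for one more factor M below. *)
have base n' t' : 0 <= t' -> t' <= 1 -> D n' t' <= E * M * Num.max 1 t' ^+ N.
  move=> h0 h1; rewrite (le_trans (small n' t' h0 h1))// (max_l h1) expr1n mulr1.
  by rewrite ler_peMr.
elim: n t t0 => [|n IH] t t0.
  rewrite /D big_ord0 mulr_ege1 ?exprn_ege1 ?le_max ?lexx// mulr_ege1//.
have /orP[t1|t1] := le_total t 1; first exact: base.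
have rt0 : 0 <= r * t by rewrite mulr_ge0// ltW.
rewrite DS (max_r t1).
apply: (le_trans (y := M * D n (r * t))).
  by rewrite ler_wpM2r ?D0// ge_min lexx.
have t1N : 1 <= t ^+ N by rewrite exprn_ege1.
have /orP[rt1|rt1] := le_total (r * t) 1.
  rewrite (le_trans (ler_wpM2l (ltW M0) (small n _ rt0 rt1)))// mulrC ler_peMr//.
  by rewrite mulr_ge0// ltW.
rewrite (le_trans (ler_wpM2l (ltW M0) (IH _ rt0)))// (max_r rt1) exprMn.
rewrite (_ : M * _ = (M * r ^+ N) * (E * M * t ^+ N)); last by ring.
by rewrite ler_piMl// !mulr_ge0 ?(ltW M0)// exprn_ge0.
Qed.

Variable d : nat.
Local Notation V := 'cV[R]_d.
Variables (m : V -> R) (pw : nat -> 'M[R]_d) (M L C r : R).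
Hypotheses (M1 : 1 <= M) (L0 : 0 <= L) (C0 : 0 <= C) (r0 : 0 < r) (r1 : r < 1).
Hypothesis mM : forall xi, `|m xi| <= M.
Hypothesis mL : forall xi, `|m xi - 1| <= L * `|xi|.
Hypothesis pwC : forall j (xi : V), `|pw j *m xi| <= C * r ^+ j * `|xi|.

Definition partial_prod n xi := \prod_(j < n) m (pw j.+1 *m xi).

Lemma partial_prod_growth : exists E N, 0 <= E /\ forall n xi,
  `|partial_prod n xi| <= E * (1 + `|xi|) ^+ N.
Proof.
have [E [N [E0 HE]]] := prod_min_bound M1 (mulr_ge0 L0 C0) r0 r1.
exists E, N; split => // n xi; apply: le_trans (HE _ n (normr_ge0 xi)).
rewrite normr_prod; apply: ler_prod => j _; rewrite normr_ge0 /= le_min mM /=.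
rewrite -[m _](subrK 1) (le_trans (ler_normD _ _))// normr1 addrC lerD2l.
rewrite (le_trans (mL _))// -!mulrA ler_wpM2l// mulrA; exact: pwC.
Qed.

(** The increments are bounded by a geometric sequence, as m (pw j xi) tends to 1
    geometrically and the partial products are bounded. *)
Lemma cvg_partial_prod xi : cvgn (partial_prod ^~ xi).
Proof.
have [E [N [E0 HE]]] := partial_prod_growth.
pose a := E * (1 + `|xi|) ^+ N * (L * (C * r * `|xi|)).
pose u n := partial_prod n xi.
have ur n : `|telescope u n| <= geometric a r n.
  rewrite /telescope /= /u /partial_prod big_ord_recr /= -/(partial_prod n xi).
  rewrite -[X in _ * _ - X]mulr1 -mulrBr normrM /a /geometric /= -(mulrA (E * (1 + `|xi|) ^+ N)) ler_pM//.
  rewrite (le_trans (mL _))// -!mulrA ler_wpM2l// (le_trans (pwC _ _))//.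
  by rewrite exprS -!mulrA ler_wpM2l// ler_wpM2l ?(ltW r0)// mulrC.
have cs : cvgn (series (telescope u)).
  apply: normed_cvg; apply: (series_le_cvg _ _ ur).
  - by move=> n; exact: normr_ge0.
  - by move=> n; exact: le_trans (ur n).
  - by apply: is_cvg_geometric_series; rewrite ger0_norm// ltW.
rewrite -/u (_ : u = fun n => u 0%N + series (telescope u) n).
  by apply: is_cvgD => //; exact: is_cvg_cst.
by apply/funext => n; exact: eq_sum_telescope.
Qed.

End infinite_product.

(** * The elliptic mask *)

Section sine_zeros.
Variable R : realType.

Lemma sqr_sinD_natpi (a : R) n : sin (a + n%:R * pi) ^+ 2 = sin a ^+ 2.
Proof.
elim: n => [|n IH]; first by rewrite mul0r addr0.
by rewrite -natr1 mulrDl mul1r addrA sinDpi sqrrN.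
Qed.

Lemma sqr_sinD_intpi (a : R) (k : int) : sin (a + k%:~R * pi) ^+ 2 = sin a ^+ 2.
Proof.
case: k => n; first exact: sqr_sinD_natpi.
by rewrite -(sqr_sinD_natpi _ n.+1) NegzE mulrNz mulNr subrK.
Qed.

Lemma sin_half_eq0 (x : R) : sin (x / 2) = 0 -> exists k : int, x = 2 * pi * k%:~R.
Proof.
move=> s0; pose k := Num.floor (x / 2 / pi); exists k.
have pi0 := pi_gt0 R.
have /andP[k1 k2] := mem_rg1_floor (x / 2 / pi); rewrite -/k in k1 k2.
pose y := x / 2 - k%:~R * pi.
have sy : sin y = 0.
  apply/eqP; rewrite -sqrf_eq0 -(sqr_sinD_intpi y k) subrK s0.
  by rewrite expr0n.
have y0 : 0 <= y by rewrite subr_ge0 -ler_pdivlMr.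
have ypi : y < pi.
  by rewrite ltrBlDr -[X in X + _]mul1r -mulrDl -ltr_pdivrMr// addrC.
have : y = 0.
  apply/eqP; rewrite eq_le y0 andbT leNgt; apply/negP => y1.
  by have := @sin_gt0_pi R y; rewrite y1 ypi => /(_ isT); rewrite sy ltxx.
rewrite /y => /eqP; rewrite subr_eq0 => /eqP E.
by rewrite -mulrA (mulrC pi) -E mulrC divfK.
Qed.

End sine_zeros.

Section mask.
Variables (R : realType) (d : nat).
Hypothesis d_gt0 : (0 < d)%N.
Local Notation V := 'cV[R]_d.
Variable A : 'M[int]_d.
Hypothesis hA : real_isotropic_dilation R A.
Variable Q : 'M[R]_d.
Hypothesis hQ : elliptic_factor A Q.
Implicit Types (x xi s : V).

Local Notation q i j := ((Q *m Q) i j).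
Local Notation G := (trigG Q).
Local Notation P := (quadP Q).
Local Notation B := (invtr R A).
Local Notation r := (dil_r R A).

Let e i : V := delta_mx i 0.

Lemma trigpoly_trigG : trigpoly 2 G.
Proof.
have z2 : 0 <= 2 :> R by [].
have ts i a : trigpoly 1 (fun xi => a * sin (xi i 0)).
  rewrite (_ : (fun _ => _) = fun xi => a * cos (- (pi / 2) + dot (e i) xi)).
    by apply: trigpoly_cos; exact: norm_delta_le1.
  apply/funext => xi; rewrite dotC dot_delta addrC cosB cos_pihalf sin_pihalf.
  by rewrite mulr0 mulr1 add0r.
rewrite (_ : G = fun xi => 4 * (\sum_(i < d) q i i * (2^-1 + (- 2^-1) * cos (0 + dot (e i) xi))) +
   2 * \sum_(i < d) \sum_(j < d | (i < j)%N) (q i j * sin (xi i 0)) * (1 * sin (xi j 0))).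
  apply: trigpolyD; apply: trigpolyZ; apply: trigpoly_sum => // i.
    apply: trigpolyZ; apply: trigpolyD; first exact: trigpoly_cst.
    by apply: trigpoly_cos; rewrite (le_trans (norm_delta_le1 _ i))// ler1n.
  apply: trigpoly_sum => // j.
  by rewrite -[2](natrD _ 1 1); apply: trigpolyM; exact: ts.
apply/funext => xi; rewrite /trigG; congr (_ * _ + _ * _).
  apply: eq_bigr => i _; congr (_ * _); rewrite add0r dotC dot_delta.
  rewrite {2}[xi i 0](splitr) cosD -!expr2 -{1}[cos _ ^+ 2](addrK (sin (xi i 0 / 2) ^+ 2)) cos2Dsin2.
  by field.
by apply: eq_bigr => i _; apply: eq_bigr => j _; rewrite mul1r.
Qed.

Let qsym i j : q i j = q j i.
Proof.
have [[Qs _] _] := hQ.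
have E : (Q *m Q)^T = Q *m Q by rewrite trmx_mul Qs.
by rewrite -[in RHS]E [RHS]mxE.
Qed.

Let sum_sym (a : 'I_d -> 'I_d -> R) : (forall i j, a i j = a j i) ->
  \sum_i \sum_j a i j = \sum_i a i i + 2 * \sum_(i < d) \sum_(j < d | (i < j)%N) a i j.
Proof.
move=> asym.
have E (i : 'I_d) : \sum_j a i j = a i i + (\sum_(j < d | (i < j)%N) a i j + \sum_(j < d | (j < i)%N) a i j).
  rewrite (bigD1 i)//= (bigID (fun j : 'I_d => (i < j)%N))/=; congr (_ + (_ + _)).
    by apply: eq_bigl => j; case: ltngtP => // ij; rewrite ?andbF ?andbT -?val_eqE /= ?gtn_eqF.
  by apply: eq_bigl => j; rewrite -leqNgt leq_eqVlt -val_eqE /=; case: ltngtP.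
under eq_bigr do rewrite E.
rewrite !big_split /=; congr (_ + _).
rewrite mulr_natl mulr2n; congr (_ + _).
rewrite (exchange_big_dep xpredT)//=; apply: eq_bigr => i _.
by apply: eq_bigr => j _.
Qed.

Lemma quadP_sum xi : P xi = \sum_i \sum_j q i j * xi i 0 * xi j 0.
Proof.
rewrite /quadP mxE exchange_big /=; apply: eq_bigr => j _.
rewrite mxE mulr_suml; apply: eq_bigr => i _; rewrite mxE; ring.
Qed.

Let colE (f : 'I_d -> R) i : (\col_i f i : V) i 0 = f i. Proof. by rewrite mxE. Qed.

Let eE i j : e i j 0 = (j == i)%:R. Proof. by rewrite mxE eqxx andbT. Qed.

(** This is 4 sin(x / 2)^2 = sin(x)^2 + 4 sin(x / 2)^4 on the diagonal terms. It
    shows that [trigG] is nonnegative and where it vanishes. *)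
Lemma trigG_decomp xi : G xi = P (\col_i sin (xi i 0)) + 4 * \sum_i q i i * sin (xi i 0 / 2) ^+ 4.
Proof.
rewrite quadP_sum; under eq_bigr do under eq_bigr do rewrite !colE.
have -> := @sum_sym (fun i j => q i j * sin (xi i 0) * sin (xi j 0)); last first.
  by move=> i j; rewrite (qsym i j); ring.
rewrite /trigG addrAC; congr (_ + _).
rewrite !mulr_sumr -big_split; apply: eq_bigr => i _ /=.
set c := cos (xi i 0 / 2); set s := sin (xi i 0 / 2).
have sE : sin (xi i 0) = 2 * (s * c) by rewrite {1}(splitr (xi i 0)) sinD -/c -/s; ring.
have cE : c ^+ 2 = 1 - s ^+ 2 by exact: cos2sin2.
rewrite sE (_ : q i i * _ * _ = 4 * q i i * s ^+ 2 * c ^+ 2); last by ring.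
by rewrite cE; ring.
Qed.

Let qii_gt0 i : 0 < q i i.
Proof.
have [c [c0 lo]] := quadP_lower hQ.
have := lo (e i); have -> : P (e i) = q i i.
  rewrite quadP_sum (bigD1 i)//= (bigD1 i)//= !eE !eqxx /= !mulr1.
  rewrite big1 ?addr0 => [|j ji]; last by rewrite eE (negbTE ji) /= mulr0.
  rewrite big1 ?addr0// => j ji; rewrite big1// => k _.
  by rewrite eE (negbTE ji) /= mulr0 mul0r.
apply: lt_le_trans; rewrite mulr_gt0// exprn_gt0//.
by apply: lt_le_trans (coord_le_norm _ i); rewrite eE eqxx normr1.
Qed.

Lemma trigG_eq0 xi : G xi = 0 -> two_pi_lattice xi.
Proof.
have [c [c0 lo]] := quadP_lower hQ.
have t0 i : true -> 0 <= q i i * sin (xi i 0 / 2) ^+ 4.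
  by move=> _; apply: mulr_ge0; [exact: ltW|exact: exprn_even_ge0].
rewrite trigG_decomp => /eqP; rewrite paddr_eq0; last 2 first.
- by apply: le_trans (lo _); exact: mulr_ge0 (ltW c0) (sqr_ge0 _).
- by rewrite mulr_ge0// sumr_ge0.
move=> /andP[_]; rewrite mulf_eq0 pnatr_eq0 /= psumr_eq0; last first.
  by [].
move=> /allP H.
have /choice[k kE] : forall i, exists k : int, xi i 0 = 2 * pi * k%:~R.
  move=> i; apply: sin_half_eq0; apply/eqP.
  have := H i (mem_index_enum _); rewrite mulf_eq0 gt_eqF//= expf_eq0 /=.
  by [].
exists (\col_i k i); apply/colP => i; rewrite !mxE; exact: kE.
Qed.

(** [trigG] and [quadP] agree to third order at the origin. *)
Lemma trigG_quadP : exists K, 0 <= K /\ forall xi, `|xi| <= 1 -> `|G xi - P xi| <= K * `|xi| ^+ 3.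
Proof.
pose K := \sum_i \sum_j `|q i j| * 2 + 4 * \sum_i `|q i i|.
exists K; split.
  rewrite addr_ge0 ?mulr_ge0 ?sumr_ge0// => i _; rewrite sumr_ge0// => j _; exact: mulr_ge0.
move=> xi x1; set t := `|xi| in x1 *.
have t0 : 0 <= t by exact: normr_ge0.
have ct i : `|xi i 0| <= t by exact: coord_le_norm.
have xt i : `|xi i 0 ^+ 2| <= t ^+ 2 by rewrite normrX lerXn2r ?nnegrE.
rewrite trigG_decomp !quadP_sum addrAC /K [leRHS]mulrDl (le_trans (ler_normD _ _))// lerD//.
  rewrite -sumrB mulr_suml (le_trans (ler_norm_sum _ _ _))//; apply: ler_sum => i _.
  rewrite -sumrB mulr_suml (le_trans (ler_norm_sum _ _ _))//; apply: ler_sum => j _.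
  rewrite !colE -!mulrA -mulrBr normrM ler_wpM2l//.
  set x := xi i 0; set y := xi j 0.
  rewrite (_ : _ - _ = (sin x - x) * sin y + x * (sin y - y)); last by ring.
  rewrite (le_trans (ler_normD _ _))// mulr_natl mulr2n !normrM lerD//.
    rewrite (exprSr t 2) ler_pM//.
      apply: le_trans (norm_sinB_le _) _; apply: le_trans (ler_norm _) (xt i).
    exact: le_trans (norm_sin_le _) (ct j).
  rewrite (exprS t 2) ler_pM// ?ct//.
  apply: le_trans (norm_sinB_le _) _; apply: le_trans (ler_norm _) (xt j).
rewrite normrM ger0_norm// -mulrA ler_wpM2l// mulr_suml (le_trans (ler_norm_sum _ _ _))//.
apply: ler_sum => i _; rewrite normrM ler_wpM2l// normrX.
apply: (le_trans (y := `|xi i 0 / 2| ^+ 4)).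
  by apply: lerXn2r; rewrite ?nnegrE// norm_sin_le.
apply: (le_trans (y := t ^+ 4)).
  apply: lerXn2r; rewrite ?nnegrE// normrM.
  by rewrite (le_trans _ (ct i))// ler_piMr// ger0_norm ?invr_ge0// invf_le1// ler1n.
by rewrite exprS ler_piMl// exprn_ge0.
Qed.

(** A digit s is determined by the integer vector A^T s, whose entries are bounded
    since those of s are. *)
Lemma finite_digits : finite_set (digits A : set V).
Proof.
(* N bounds every entry of A^T s; the shift by N encodes an integer of absolute
   value at most N as an ordinal. *)
pose N : nat := (\sum_i \sum_j `|A i j|)%N.
pose f (k : 'cV['I_(N + N).+1]_d) : V :=
  B *m (\col_i ((k i 0)%:Z - N%:Z)%:~R).
apply: (@sub_finite_set _ _ (f @` [set: 'cV['I_(N + N).+1]_d])); last first.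
  by apply: finite_image; exact: finite_finset.
move=> s [s01 [k kE]].
have kN i : (absz (k i 0%R) <= N)%N.
  have kiE : (k i 0)%:~R = \sum_j (A j i)%:~R * s j 0 :> R.
    by have := congr1 (fun v : V => v i 0) kE; rewrite !mxE => <-; apply: eq_bigr => j _; rewrite !mxE.
  rewrite -(ler_nat R) natr_absz intr_norm kiE /N exchange_big natr_sum.
  rewrite [leRHS](bigD1 i)//= -[leLHS]addr0 lerD ?sumr_ge0//.
  rewrite natr_sum (le_trans (ler_norm_sum _ _ _))//; apply: ler_sum => j _.
  have /andP[s0 s1] := s01 j.
  by rewrite normrM natr_absz intr_norm ler_piMr// ger0_norm// ltW.
have kb i : (absz (k i 0%R + N%:Z)%R < (N + N).+1)%N.
  by have := kN i; lia.
exists (\col_i Ordinal (kb i)) => //.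
rewrite /f; have -> : s = B *m ((map_mx intr A)^T *m s) by rewrite mulmxA mulVmx ?mul1mx// (dil_unit d_gt0 hA).
congr (_ *m _); rewrite kE; apply/colP => i; rewrite !mxE /=; congr (_%:~R).
by have := kN i; lia.
Qed.

Lemma two_pi_lattice_digit s : (digits A `\ 0) s -> ~ two_pi_lattice ((2 * pi) *: s).
Proof.
move=> [[s01 _] /= s0] [k kE]; apply: s0.
have pi2 : 2 * pi != 0 :> R by rewrite mulf_neq0// lt0r_neq0// pi_gt0.
have sk : s = map_mx intr k by apply: (scalerI pi2).
apply/colP => i; rewrite sk !mxE; have := s01 i; rewrite sk mxE.
rewrite -[1]/(1%:~R) -[0]/(0%:~R : R) ler_int ltr_int => h.
by congr (_%:~R); lia.
Qed.

Local Notation m0 := (mask_m0 A Q).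

Local Notation Ds := (finmap.enum_fset (fset_set (digits A `\ (0 : V)))).

Let mask_prod xi : m0 xi = \prod_(s <- Ds)
  (G (xi + (2 * pi) *: s) / G ((2 * pi) *: s)).
Proof. by rewrite /mask_m0 fsbig_finite//; apply: finite_setD; exact: finite_digits. Qed.

Lemma trigpoly_mask : exists rho, 0 <= rho /\ trigpoly rho m0.
Proof.
exists (\sum_(s <- Ds) 2); split.
  by rewrite sumr_ge0.
rewrite (_ : m0 = fun xi => \prod_(s <- Ds)
  (G (xi + (2 * pi) *: s) / G ((2 * pi) *: s))); last exact/funext/mask_prod.
apply: trigpoly_prod => s.
under eq_fun do rewrite mulrC.
by apply: trigpolyZ; apply: trigpoly_shift; exact: trigpoly_trigG.
Qed.

Lemma mask_m0_at0 : m0 0 = 1.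
Proof.
rewrite mask_prod big_seq big1// => s.
rewrite in_fset_set; last by apply: finite_setD; exact: finite_digits.
rewrite inE => sD; rewrite add0r divff//; apply/eqP => /trigG_eq0.
exact: two_pi_lattice_digit.
Qed.

Lemma lattice_invtr xi : two_pi_lattice (B *m xi) -> two_pi_lattice xi.
Proof.
move=> [k kE]; exists (A^T *m k).
rewrite -[LHS](mulmx_invtr d_gt0 hA) kE -scalemxAr; congr (_ *: _).
by rewrite map_mxM map_trmx.
Qed.

Lemma lattice_invtr_pow j xi : two_pi_lattice (invtr_pow R A j *m xi) -> two_pi_lattice xi.
Proof.
elim: j => [|j IH]; first by rewrite mul1mx.
by rewrite /= -mulmxA => /lattice_invtr.
Qed.

Lemma lattice0 : two_pi_lattice (0 : V).
Proof. by exists 0; rewrite map_mx0 scaler0. Qed.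

(** The factors trigG (B^j xi) telescope. *)
Lemma prod_mu n xi : ~ two_pi_lattice xi ->
  \prod_(0 <= j < n) mu A Q (iter j (mulmx B) xi) =
  (dil_q R A `^ (2 / d%:R)) ^+ n * partial_prod m0 (invtr_pow R A) n xi *
    G (invtr_pow R A n *m xi) / G xi.
Proof.
move=> xiL; have G0 j : G (invtr_pow R A j *m xi) != 0.
  by apply/eqP => /trigG_eq0/lattice_invtr_pow.
have := G0 0%N; rewrite mul1mx => G00.
elim: n => [|n IH].
  by rewrite big_geq// /partial_prod big_ord0 expr0 !mul1r mul1mx divff.
rewrite big_nat_recr//= IH /mu iter_invtr.
case: asboolP => [/lattice_invtr_pow//|_].
rewrite /mu_quotient /partial_prod big_ord_recr /= -/(partial_prod m0 _ n xi) mulmxA exprSr.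
by field; rewrite G0 G00.
Qed.

(** The difference is O(|x|^3) and [quadP] is at least a multiple of |x|^2, at
    x = B^n xi, which tends to 0. *)
Lemma cvg_trigG_quadP xi : xi != 0 ->
  G (invtr_pow R A n *m xi) / P (invtr_pow R A n *m xi) @[n --> \oo] --> (1 : R).
Proof.
move=> xi0.
have [K [K0 HK]] := trigG_quadP; have [c [c0 lo]] := quadP_lower hQ.
have [C [C0 HC]] := norm_invtr_pow d_gt0 hA hQ.
have r0 := dil_r_gt0 d_gt0 hA; have r1 := dil_r_lt1 d_gt0 hA.
pose x n := invtr_pow R A n *m xi.
have xb n : `|x n| <= C * `|xi| * r ^+ n by rewrite mulrAC; exact: HC.
have cb : C * `|xi| * r ^+ n @[n --> \oo] --> (0 : R).
  rewrite -(mulr0 (C * `|xi|)); apply: cvgMr; apply: cvg_expr.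
  by rewrite ger0_norm// ltW.
have P0 n : 0 < P (x n).
  rewrite /x (quadP_pow hQ) mulr_gt0 ?exprn_gt0//.
  by apply: lt_le_trans (lo xi); rewrite mulr_gt0// exprn_gt0// normr_gt0.
apply/cvgrPdist_le => eps eps0.
have e1 : 0 < Num.min 1 (eps * c / (K + 1)).
  by rewrite lt_min ltr01 divr_gt0 ?mulr_gt0// ltr_wpDl.
move/cvgrPdist_le : cb => /(_ _ e1); apply: filterS => n.
rewrite sub0r normrN ger0_norm; last by rewrite !mulr_ge0// exprn_ge0// ltW.
move=> /(le_trans (xb n)); rewrite le_min => /andP[x1 x2].
rewrite -/(x n) -[X in X - _](divff (lt0r_neq0 (P0 n))) -mulrBl normrM normfV.
rewrite (ger0_norm (ltW (P0 n))) ler_pdivrMr// distrC (le_trans (HK _ x1))//.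
apply: (le_trans (y := eps * (c * `|x n| ^+ 2))); last first.
  by rewrite ler_wpM2l// ltW.
rewrite (_ : K * _ = K * `|x n| * `|x n| ^+ 2); last by ring.
rewrite (mulrA eps) ler_wpM2r ?sqr_ge0//.
apply: (le_trans (y := (K + 1) * `|x n|)); first by rewrite ler_wpM2r// lerDl.
by rewrite mulrC -ler_pdivlMr// ltr_wpDl.
Qed.

(** By [prod_mu] and [quadP_pow] the partial products defining [phihat] are p_n
    times a quotient that tends to 1 by [cvg_trigG_quadP]. *)
Lemma cvg_phihat xi (l : R) : ~ two_pi_lattice xi ->
  partial_prod m0 (invtr_pow R A) n xi @[n --> \oo] --> l -> phihat A Q xi = l.
Proof.
move=> xiL cl.
have xi0 : xi != 0 by apply/eqP => xi0; apply: xiL; rewrite xi0; exact: lattice0.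
have G0 : G xi != 0 by apply/eqP => /trigG_eq0.
have [c [c0 lo]] := quadP_lower hQ.
have P0 : P xi != 0.
  by rewrite lt0r_neq0// (lt_le_trans _ (lo xi))// mulr_gt0// exprn_gt0// normr_gt0.
have r0 := dil_r_gt0 d_gt0 hA.
rewrite /phihat (negbTE xi0) /prodM.
have -> : limn (fun n => \prod_(0 <= j < n) mu A Q (iter j (mulmx B) xi)) = l * (P xi / G xi).
  apply: cvg_lim => //.
  rewrite (_ : (fun n => _) = fun n => partial_prod m0 (invtr_pow R A) n xi *
    (G (invtr_pow R A n *m xi) / P (invtr_pow R A n *m xi)) * (P xi / G xi)).
    apply: cvgMl; rewrite -[X in _ --> X]mulr1; apply: cvgM => //.
    exact: cvg_trigG_quadP.
  apply/funext => n; rewrite prod_mu// (quadP_pow hQ).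
  have -> : (dil_q R A `^ (2 / d%:R)) ^+ n = r ^- (2 * n).
    apply: (mulIf (expf_neq0 (2 * n) (lt0r_neq0 r0))).
    by rewrite mulVf ?expf_neq0 ?lt0r_neq0// exprM -exprMn (dil_q_powR d_gt0 hA) expr1n.
  by field; rewrite G0 P0 expf_neq0// lt0r_neq0.
by field; rewrite G0 P0.
Qed.

End mask.

(** * Support of the scaling function *)

Section lattice_null.
Variable R : realType.
Local Notation T := (measurableTypeR R).

Lemma measurable_tuple_set1 n (t : n.-tuple T) : measurable [set t].
Proof.
have -> : [set t] = \bigcap_(i in [set: 'I_n]) ((@tnth _ T ^~ i) @^-1` [set tnth t i]).
  apply/seteqP; split => [s -> //|s h].
  by apply: eq_from_tnth => i; exact: h.
apply: fin_bigcap_measurable => // i _.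
by rewrite -[X in measurable X]setTI; apply: measurable_tnth => //; exact: measurable_set1.
Qed.

Lemma countable_two_pi_lattice d : countable [set t : d.-tuple T | two_pi_lattice (colv t)].
Proof.
pose g (k : 'cV[int]_d) : d.-tuple T := tuplev ((2 * pi : R) *: map_mx intr k).
have S : [set t : d.-tuple T | two_pi_lattice (colv t)] `<=` range g.
  by move=> t [k kE]; exists k => //; rewrite /g -kE colvK.
apply: (sub_countable (subset_card_le S)); apply: (sub_countable (card_image_le _ _)).
exact: countableP.
Qed.

(** The first coordinate of a lattice point lies in the countable set 2 pi Z. *)
Lemma two_pi_lattice_null d : (0 < d)%N ->
  lebesgue_tuple d [set t : d.-tuple T | two_pi_lattice (colv t)] = 0%E.
Proof.
case: d => // n _.
pose Z : set T := range (fun k : int => 2 * pi * k%:~R).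
have cZ : countable Z.
  by apply: (sub_countable (card_image_le _ _)); exact: countableP.
have mZ : measurable Z by apply: countable_measurable => // z; exact: measurable_set1.
have mN := countable_measurable (@measurable_tuple_set1 n.+1) (countable_two_pi_lattice n.+1).
pose N' : set (n.+1.-tuple T) := (fun t => thead t) @^-1` Z.
have mN' : measurable N'.
  by rewrite -[X in measurable X]setTI; apply: (measurable_tnth ord0).
apply: (@subset_measure0 _ _ _ _ _ N') => //.
  by move=> t [k kE]; exists (k ord0 0); have := congr1 (fun v : 'cV[R]_n.+1 => v ord0 0) kE; rewrite !mxE.
change ((@lebesgue_measure R \x lebesgue_tuple n)%E (@consp R n @^-1` N') = 0%E).
have -> : @consp R n @^-1` N' = Z `*` setT.
  by apply/seteqP; split => -[x t] //= [].
rewrite product_measure1E//; have := countable_lebesgue_measure0 cZ => /= ->.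
by rewrite mul0e.
Qed.

End lattice_null.

Section compact_support.
Variables (R : realType) (d : nat).
Hypothesis d_gt0 : (0 < d)%N.
Local Notation T := (measurableTypeR R).
Local Notation V := 'cV[R]_d.
Variable A : 'M[int]_d.
Hypothesis hA : real_isotropic_dilation R A.
Variable Q : 'M[R]_d.
Hypothesis hQ : elliptic_factor A Q.

Local Notation m0 := (mask_m0 A Q).
Local Notation p := (partial_prod m0 (invtr_pow R A)).
Local Notation r := (dil_r R A).
Local Notation L := [set t : d.-tuple T | two_pi_lattice (colv t)].

(** The frequencies of m0(B^j xi) are those of m0 mapped by the transpose of B^j,
    so their norms are O(r^j), and the radii add up to a geometric series. *)
Lemma partial_prod_trigpoly : exists rho, 0 <= rho /\ forall n, trigpoly rho (p n).
Proof.
have [rho [rho0 tm]] := trigpoly_mask d_gt0 hA Q.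
have [C [C0 HC]] := norm_invtr_pow_tr d_gt0 hA hQ.
have r0 := dil_r_gt0 d_gt0 hA; have r1 := dil_r_lt1 d_gt0 hA.
(* The ball for m0(B^j xi) has radius C r^j rho. *)
have r1' : 0 < 1 - r by rewrite subr_gt0.
exists (C * rho / (1 - r)); split; first by rewrite !mulr_ge0// invr_ge0 ltW.
move=> n; apply: (@trigpoly_le _ _ (\sum_(j < n) C * r ^+ j.+1 * rho)); last first.
  apply: trigpoly_prod => j; apply: trigpoly_comp tm => k kr.
  by rewrite (le_trans (HC _ _))// ler_wpM2l// mulr_ge0// exprn_ge0// ltW.
rewrite ler_pdivlMr// (_ : \sum_(j < n) _ = C * rho * \sum_(j < n) r ^+ j.+1); last first.
  by rewrite mulr_sumr; apply: eq_bigr => j _; ring.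
rewrite -(mulrA (C * rho)) sum_geometricS ler_piMr ?mulr_ge0// lerBlDr (le_trans (ltW r1))// lerDl.
by rewrite exprn_ge0// ltW.
Qed.

Lemma mask_infinite_product : (exists E N, forall n xi, `|p n xi| <= E * (1 + `|xi|) ^+ N) /\
  forall xi, cvgn (p ^~ xi).
Proof.
have [rho [rho0 tm]] := trigpoly_mask d_gt0 hA Q.
have [M [M1 mM]] := trigpoly_bounded tm.
have [K [K0 mK]] := trigpoly_lipschitz tm.
have [C [C0 HC]] := norm_invtr_pow d_gt0 hA hQ.
have r0 := dil_r_gt0 d_gt0 hA; have r1 := dil_r_lt1 d_gt0 hA.
have mK1 xi : `|m0 xi - 1| <= K * `|xi|.
  by have := mK xi 0; rewrite (mask_m0_at0 d_gt0 hA hQ) subr0.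
split; last by move=> xi; exact: (cvg_partial_prod M1 K0 C0 r0 r1 mM mK1 HC).
have [E [N [_ H]]] := partial_prod_growth M1 K0 C0 r0 r1 mM mK1 HC.
by exists E, N.
Qed.

Lemma cvg_partial_prod_phihat xi : ~ two_pi_lattice xi -> p n xi @[n --> \oo] --> phihat A Q xi.
Proof.
move=> xiL; have /cvg_ex[/= l cl] := mask_infinite_product.2 xi.
by rewrite (cvg_phihat d_gt0 hA hQ xiL cl).
Qed.

Let mL : measurable L.
Proof.
exact: countable_measurable (@measurable_tuple_set1 R d) (@countable_two_pi_lattice R d).
Qed.

Lemma continuous_partial_prod n : continuous (p n).
Proof. by have [rho [_ /(_ n)]] := partial_prod_trigpoly; exact: continuous_trigpoly. Qed.

(** Off the lattice [phihat] is a limit of continuous functions; on the lattice,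
    which is countable, every function is measurable. *)
Lemma vmeasurable_phihat : vmeasurable (phihat A Q).
Proof.
rewrite /vmeasurable -(setUv L); apply/measurable_funU => //; first exact: measurableC.
split.
  move=> _ Y mY; apply: countable_measurable; first exact: measurable_tuple_set1.
  apply: sub_countable (@countable_two_pi_lattice R d).
  by apply: subset_card_le; exact: subIsetl.
apply: (@measurable_fun_cvg _ _ _ _ (fun n t => p n (colv t))).
  by move=> n; apply: measurable_funTS; exact: measurable_continuous (@continuous_partial_prod n).
by move=> t Lt; exact: cvg_partial_prod_phihat.
Qed.

Lemma rintegral_phihat g : continuous g ->
  (forall N, exists B, forall xi, (1 + `|xi|) ^+ N * `|g xi| <= B * weight xi) ->
  (forall n, rintegral (fun xi => p n xi * g xi) = 0) ->
  rintegral (fun xi => phihat A Q xi * g xi) = 0.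
Proof.
move=> cg gd pg0; have [[E [N pN]] _] := mask_infinite_product.
have [B gB] := gd N.
have E0 : 0 <= E.
  by have := le_trans (normr_ge0 _) (pN 0%N 0); rewrite normr0 addr0 expr1n mulr1.
have mg := measurable_continuous cg.
have : rintegral (fun xi => p n xi * g xi) @[n --> \oo] --> rintegral (fun xi => phihat A Q xi * g xi).
  apply: (@rintegral_dominated _ _ _ _ (fun xi => E * B * weight xi) L) => //.
  - move=> n; apply: measurable_funM => //.
    exact: measurable_continuous (@continuous_partial_prod n).
  - by apply: measurable_funM => //; exact: vmeasurable_phihat.
  - exact: two_pi_lattice_null.
  - by move=> t Lt; apply: cvgMl; exact: cvg_partial_prod_phihat.
  - by apply: vintegrableZ; exact: vintegrable_weight.
  - move=> n xi; rewrite normrM (le_trans (ler_wpM2r (normr_ge0 _) (pN n xi)))//.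
    by rewrite -!mulrA ler_wpM2l.
under eq_fun do rewrite pg0.
by move=> /cvg_lim <- //; rewrite lim_cst.
Qed.

End compact_support.

Theorem proposition3p1 (R : realType) (d : nat) (hd : (0 < d)%N)
    (A : 'M[int]_d) (hA : real_isotropic_dilation R A)
    (Q : 'M[R]_d) (hQ : elliptic_factor A Q)
    (phi : ('cV[R]_d -> R[i]) -> R[i])
    (hphi : elliptic_scaling_function A Q phi) :
  compactly_supported phi.
Proof.
have [rho [rho0 tp]] := partial_prod_trigpoly hd hA hQ.
pose U := [set x : 'cV[R]_d | rho < `|x|].
have oU : open U.
  apply: (open_comp (f := fun y : 'cV[R]_d => `|y|) (D := [set t : R | rho < t])) => [y _|].
    exact: norm_continuous.
  exact: open_gt.
have vU : vanishes_on phi U.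
  move=> f sf cf fU.
  have f0 k : `|k| <= rho -> f k = 0.
    move=> kr; apply/eqP; apply: contraT => fk.
    by have := fU k (@subset_closure _ [set x | f x != 0] k fk); rewrite /U /= ltNge kr.
  have [g1 [g2 [sg gf g0 gd]]] := inverse_fourier sf cf.
  have H g : g = g1 \/ g = g2 -> rintegral (fun xi => phihat A Q xi * g xi) = 0.
    move=> gg; have [cg dg] := gd g gg.
    apply: rintegral_phihat => // n; apply: rintegral_trigpoly0 (tp n) _ cg _.
      move=> psi k kr; rewrite -[RHS](g0 g gg psi k); last 2 first.
      - exact: f0.
      - by apply: f0; rewrite normrN.
      by apply: eq_rintegral => xi; rewrite dotC.
    by have [B HB] := dg 0%N; exists B => xi; have := HB xi; rewrite expr0 mul1r.
  have := hphi.2 _ sg; rewrite /fourier_distribution gf => ->.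
  rewrite /regular_distribution /cintegral.
  rewrite (@eq_rintegral _ _ _ (fun xi => phihat A Q xi * g1 xi)); last first.
    by move=> xi /=; rewrite mul0r subr0.
  rewrite (@eq_rintegral _ _ (fun xi => complex.Im _) (fun xi => phihat A Q xi * g2 xi)); last first.
    by move=> xi /=; rewrite mul0r addr0.
  by rewrite (H g1 (or_introl erefl)) (H g2 (or_intror erefl)).
apply: (@cV_bounded_closed_compact _ _ _ rho).
  by move=> x xS; rewrite leNgt; apply/negP => xU; apply: xS; exists U.
rewrite closedC; apply: bigcup_open => W [].
by [].
Qed.
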